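(* Let $A$ be a finite alphabet and let $\sigma:A\to A^+$ be a primitive aperiodic non-proper substitution. Then the inductive limit of the system of ordered groups $$\frac{\mathbf Z^{|A^{\mathcal Q}|}}{\Delta\mathbf Z^{|A^{\mathcal Q}|}}\xrightarrow{\beta^{\mathcal Q}}\frac{\mathbf Z^{|A^{\mathcal Q}|}}{\Delta\mathbf Z^{|A^{\mathcal Q}|}}\xrightarrow{\beta^{\mathcal Q}}\frac{\mathbf Z^{|A^{\mathcal Q}|}}{\Delta\mathbf Z^{|A^{\mathcal Q}|}}\xrightarrow{\beta^{\mathcal Q}}\cdots$$ is isomorphic (as an ordered group) to the dimension group $K^0(X_\sigma,T_\sigma)$ of the substitutional system associated to $(A,\sigma)$.
   Context: **Substitutions.** $A^+$ is the set of non-empty finite words in the letters of $A$; $\sigma$ extends to words by concatenation, and $\sigma^n$ denotes iterates. $\sigma$ is primitive if there is $n$ such that for all $a,b\in A$ the letter $b$ occurs in $\sigma^n(a)$. $X_\sigma\subseteq A^{\mathbf Z}$ is the set of bi-infinite sequences all of whose finite subwords occur as subwords of $\sigma^n(a)$ for some $a\in A$ and some $n$, and $T_\sigma$ is the shift $(T_\sigma x)_i=x_{i+1}$; $(X_\sigma,T_\sigma)$ is the substitutional dynamical system associated to $(A,\sigma)$. $\sigma$ is aperiodic if $X_\sigma$ is infinite. $\sigma$ is proper if there are $p>0$ and letters $l,r\in A$ such that for every $a\in A$ the first letter of $\sigma^p(a)$ is $l$ and the last letter of $\sigma^p(a)$ is $r$; non-proper means not proper. **Tripling.** $A^{\mathcal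 Q}=\{(a,b,c)\in A\times A\times A: abc$ occurs as a subword of $\sigma^n(d)$ for some $d\in A$ and some $n\}$. The substitution $\sigma^{\mathcal Q}:A^{\mathcal Q}\to(A^{\mathcal Q})^+$ is $$\sigma^{\mathcal Q}[(a,b,c)]=(a_m,b_1,b_2)\cdot(b_1,b_2,b_3)\cdots(b_{n-2},b_{n-1},b_n)\cdot(b_{n-1},b_n,c_1),$$ where $\sigma(b)=b_1b_2\cdots b_n$, $a_m$ is the last letter of $\sigma(a)$ and $c_1$ is the first letter of $\sigma(c)$ (that is, the word of length $n$ whose $i$-th letter is $(b_{i-1},b_i,b_{i+1})$ with $b_0:=a_m$, $b_{n+1}:=c_1$). **The groups.** $\mathbf Z^{|A^{\mathcal Q}|}$ is the group of integer-valued functions on $A^{\mathcal Q}$ with pointwise order. For $\varphi:A\times A\to\mathbf Z$, $\delta(\varphi)\in\mathbf Z^{|A^{\mathcal Q}|}$ is $\delta(\varphi)(a,b,c)=\varphi(b,c)-\varphi(a,b)$, and $\Delta\mathbf Z^{|A^{\mathcal Q}|}=\delta(\mathbf Z^{|A\times A|})$ is the subgroup of all $\delta(\varphi)$. The quotient $\mathbf Z^{|A^{\mathcal Q}|}/\Delta\mathbf Z^{|A^{\mathcal Q}|}$ is an ordered group whose positive cone is the image of the non-negative functions. $\beta^{\mathcal Q}:\mathbf Z^{|A^{\mathcal Q}|}\to\mathbf Z^{|A^{\mathcal Q}|}$ is multiplication by the incidence matrix of $\sigma^{\mathcal Q}$: $(\beta^{\mathcal Q}p)(t)=\sum_i p(t_i)$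 where $\sigma^{\mathcal Q}(t)=t_1t_2\cdots t_k$. It maps $\Delta\mathbf Z^{|A^{\mathcal Q}|}$ into itself, and the induced homomorphism of the quotient ordered group is still denoted $\beta^{\mathcal Q}$. The inductive limit carries the induced order. **The group $K^0$.** For a Cantor minimal system $(X,T)$, $C(X,\mathbf Z)$ is the group of continuous integer-valued functions, $\partial_T(f)=f-f\circ T$, $K^0(X,T)=C(X,\mathbf Z)/\partial_TC(X,\mathbf Z)$, with positive cone $\{[f]: f\in C(X,\mathbf Z),\ f\ge0\}$. *)

(* Defs.v *)
From HB Require Import structures.
From mathcomp Require Import all_boot all_order all_algebra.
From mathcomp Require Import all_classical.
From mathcomp Require Import topology.
From mathcomp Require Import zify.

Set Implicit Arguments.
Unset Strict Implicit.
Unset Printing Implicit Defensive.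

Import Order.TTheory GRing.Theory Num.Theory.
Local Open Scope ring_scope.
Local Open Scope classical_set_scope.
Local Open Scope quotient_scope.

(* An abelian group with a positive cone; the order is
   x <= y <-> pos_cone (y - x).  Antisymmetry of the order is not required
   here: for the groups below it depends on the substitution being primitive. *)
Record ordGroup := OrdGroup {
  og_sort :> zmodType;
  pos_cone : set og_sort;
  pos_cone0 : pos_cone 0;
  pos_coneD : forall x y, pos_cone x -> pos_cone y -> pos_cone (x + y) }.
Arguments pos_cone {_} _.

Record ordHom (G H : ordGroup) := OrdHom {
  ordHom_fun :> {additive G -> H};
  ordHom_pos : forall x, pos_cone x -> pos_cone (ordHom_fun x) }.

Definition ord_isomorphic (G H : ordGroup) : Prop :=
  exists f : {additive G -> H},
    bijective f /\ forall x, pos_cone x <-> pos_cone (f x).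

Section Cokernel.
Variables (V : zmodType) (G : ordGroup) (h : {additive V -> G}).

(* G modulo the image of h; the positive cone is the image of that of G. *)
Definition im_pred : {pred G} := [pred w | `[< exists v, w = h v >]].

Lemma im_pred_closed : zmod_closed im_pred.
Proof.
split; first by apply/asboolP; exists 0; rewrite raddf0.
by move=> _ _ /asboolP[x ->] /asboolP[y ->]; apply/asboolP; exists (x - y);
   rewrite raddfB.
Qed.
HB.instance Definition _ := GRing.isZmodClosed.Build G im_pred im_pred_closed.

Definition coker_sort : zmodType := Quotient.quot im_pred.
Definition coker_pi (x : G) : coker_sort := \pi_(Quotient.quot im_pred) x.

Lemma coker_piD x y : coker_pi (x + y) = coker_pi x + coker_pi y.
Proof. by rewrite /coker_pi raddfD. Qed.

Lemma coker_pi_eq x y : coker_pi x = coker_pi y <-> exists v, x - y = h v.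
Proof.
rewrite /coker_pi; split; first by move/eqP; rewrite -Quotient.idealrBE => /asboolP.
by move=> vP; apply/eqP; rewrite -Quotient.idealrBE; apply/asboolP.
Qed.

Definition coker_cone : set coker_sort := [set coker_pi x | x in pos_cone].

Lemma coker_cone0 : coker_cone 0.
Proof.
exists 0; first exact: pos_cone0.
by rewrite /coker_pi raddf0.
Qed.

Lemma coker_coneD x y : coker_cone x -> coker_cone y -> coker_cone (x + y).
Proof.
move=> [u pu <-] [v pv <-]; exists (u + v); first exact: pos_coneD.
exact: coker_piD.
Qed.

Definition coker : ordGroup := OrdGroup coker_cone0 coker_coneD.

End Cokernel.

Section CokernelMap.
Variables (V : zmodType) (G : ordGroup) (h : {additive V -> G}).
Variables (f : ordHom G G) (f_im : forall v, exists v', f (h v) = h v').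

Definition coker_map_fun (x : coker h) : coker h := coker_pi h (f (repr x)).

Lemma coker_map_pi x : coker_map_fun (coker_pi h x) = coker_pi h (f x).
Proof.
apply/coker_pi_eq; rewrite -raddfB.
have /coker_pi_eq[v ->] : coker_pi h (repr (coker_pi h x)) = coker_pi h x.
  exact: reprK.
exact: f_im.
Qed.

Lemma coker_map_additive : zmod_morphism coker_map_fun.
Proof.
move=> x y.
have [u <-] : exists u, coker_pi h u = x by exists (repr x); exact: reprK.
have [v <-] : exists v, coker_pi h v = y by exists (repr y); exact: reprK.
have piB u' v' : coker_pi h u' - coker_pi h v' = coker_pi h (u' - v').
  by rewrite /coker_pi raddfB.
rewrite !coker_map_pi; apply: etrans (congr1 coker_map_fun (piB u v)) _.
by rewrite coker_map_pi raddfB; apply: esym; exact: piB.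
Qed.
HB.instance Definition _ :=
  GRing.isZmodMorphism.Build (coker h) (coker h) coker_map_fun
    coker_map_additive.

Lemma coker_map_pos (x : coker h) : pos_cone x -> pos_cone (coker_map_fun x).
Proof.
move=> [u pu <-]; rewrite coker_map_pi; exists (f u) => //.
exact: ordHom_pos.
Qed.

Definition coker_map : ordHom (coker h) (coker h) := OrdHom coker_map_pos.

End CokernelMap.

(* The inductive limit of G -f-> G -f-> G -f-> ...; the class of (n, x) is the
   image of the element x of the n-th copy of G. *)
Section Limit.
Variables (G : ordGroup) (f : ordHom G G).

Definition lim_equiv (a b : nat * G) : bool :=
  `[< exists k, iter (k + b.1) f a.2 = iter (k + a.1) f b.2 >].

Lemma lim_equiv_class : equiv_class_of lim_equiv.
Proof.
split.
- by move=> a; apply/asboolP; exists 0%N.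
- by move=> a b; apply/asboolP/asboolP => -[k e]; exists k.
move=> [n y] [m x] [p z] /asboolP[/= k e1] /asboolP[/= l e2].
apply/asboolP; exists (k + l + n)%N => /=.
have -> : (k + l + n + p = (l + p) + (k + n))%N by lia.
have -> : (k + l + n + m = (k + m) + (l + n))%N by lia.
by rewrite iterD e1 [RHS]iterD -e2 -!iterD addnC.
Qed.

Canonical lim_equiv_equiv := EquivRelPack lim_equiv_class.
Canonical lim_equiv_encModRel := defaultEncModRel lim_equiv.

Definition lim_sort := {eq_quot lim_equiv}.
HB.instance Definition _ := EqQuotient.on lim_sort.
HB.instance Definition _ := Choice.on lim_sort.

Definition lim_in (n : nat) (x : G) : lim_sort := \pi_lim_sort (n, x).

Lemma lim_inP (a : lim_sort) : exists n x, a = lim_in n x.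
Proof.
by exists (repr a).1, (repr a).2; rewrite /lim_in -surjective_pairing reprK.
Qed.

Lemma lim_in_eq n x m y :
  lim_in n x = lim_in m y <-> exists k, iter (k + m) f x = iter (k + n) f y.
Proof.
split; first by move/eqmodP => /asboolP.
by move=> e; apply/eqmodP/asboolP.
Qed.

Lemma lim_in_iter k n x : lim_in (k + n) (iter k f x) = lim_in n x.
Proof. by apply/lim_in_eq; exists 0%N; rewrite -iterD addnC. Qed.

Lemma iter_ordHomB k : {morph iter k f : x y / x - y}.
Proof. by move=> x y; elim: k => //= k ->; rewrite raddfB. Qed.

Lemma iter_ordHom0 k : iter k f 0 = 0.
Proof. by elim: k => //= k ->; rewrite raddf0. Qed.

Lemma iter_ordHomN k : {morph iter k f : x / - x}.
Proof. by move=> x; elim: k => //= k ->; rewrite raddfN. Qed.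

Lemma iter_ordHomD k : {morph iter k f : x y / x + y}.
Proof. by move=> x y; elim: k => //= k ->; rewrite raddfD. Qed.

Definition lim_opp (a : lim_sort) : lim_sort := lim_in (repr a).1 (- (repr a).2).

Definition lim_add (a b : lim_sort) : lim_sort :=
  lim_in ((repr a).1 + (repr b).1)
    (iter (repr b).1 f (repr a).2 + iter (repr a).1 f (repr b).2).

Lemma repr_lim_in n x : exists k,
  iter (k + n) f (repr (lim_in n x)).2 = iter (k + (repr (lim_in n x)).1) f x.
Proof.
by apply/lim_in_eq; rewrite {1}/lim_in -surjective_pairing reprK.
Qed.

Lemma lim_opp_in n x : lim_opp (lim_in n x) = lim_in n (- x).
Proof.
rewrite /lim_opp; case: (repr_lim_in n x) => k e; apply/lim_in_eq; exists k.
by rewrite !iter_ordHomN e.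
Qed.

Lemma lim_add_in n x m y :
  lim_add (lim_in n x) (lim_in m y) = lim_in (n + m) (iter m f x + iter n f y).
Proof.
rewrite /lim_add; case: (repr_lim_in n x) => k; case: (repr_lim_in m y) => l.
move: (repr (lim_in n x)) (repr (lim_in m y)) => [n' x'] [m' y'] /= ey ex.
apply/lim_in_eq; exists (k + l)%N; rewrite !iter_ordHomD -!iterD.
congr (_ + _).
  have -> : (k + l + (n + m) + m' = (l + m + m') + (k + n))%N by lia.
  by rewrite iterD ex -iterD; congr (iter _ _ _); lia.
have -> : (k + l + (n + m) + n' = (k + n + n') + (l + m))%N by lia.
by rewrite iterD ey -iterD; congr (iter _ _ _); lia.
Qed.

Lemma lim_addA : associative lim_add.
Proof.
move=> a b c; have [n [x ->]] := lim_inP a; have [m [y ->]] := lim_inP b.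
have [p [z ->]] := lim_inP c; rewrite !lim_add_in addnA; congr lim_in.
rewrite !iter_ordHomD -!iterD addrA.
by congr (_ + _ + _); congr (iter _ _ _); lia.
Qed.

Lemma lim_addC : commutative lim_add.
Proof.
move=> a b; have [n [x ->]] := lim_inP a; have [m [y ->]] := lim_inP b.
by rewrite !lim_add_in addnC addrC.
Qed.

Lemma lim_add0 : left_id (lim_in 0 0) lim_add.
Proof.
move=> a; have [n [x ->]] := lim_inP a.
by rewrite lim_add_in iter_ordHom0 add0r.
Qed.

Lemma lim_addN : left_inverse (lim_in 0 0) lim_opp lim_add.
Proof.
move=> a; have [n [x ->]] := lim_inP a; rewrite lim_opp_in lim_add_in.
by rewrite iter_ordHomN addNr; apply/lim_in_eq; exists 0%N; rewrite !iter_ordHom0.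
Qed.

HB.instance Definition _ :=
  GRing.isZmodule.Build lim_sort lim_addA lim_addC lim_add0 lim_addN.

Definition lim_cone : set lim_sort :=
  [set a | exists n x, pos_cone x /\ a = lim_in n x].

Lemma lim_cone0 : lim_cone 0.
Proof. by exists 0%N, 0; split => //; exact: pos_cone0. Qed.

Lemma iter_ordHom_pos k (x : G) : pos_cone x -> pos_cone (iter k f x).
Proof. by move=> px; elim: k => //= k; exact: ordHom_pos. Qed.

Lemma lim_coneD a b : lim_cone a -> lim_cone b -> lim_cone (a + b).
Proof.
move=> [n [x [px ->]]] [m [y [py ->]]].
exists (n + m)%N, (iter m f x + iter n f y); split; last exact: lim_add_in.
by apply: pos_coneD; exact: iter_ordHom_pos.
Qed.

Definition ind_lim : ordGroup := OrdGroup lim_cone0 lim_coneD.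

End Limit.

Section ContinuousIntegerFunctions.
Variable X : topologicalType.

(* Z carries the discrete topology. *)
Definition continuousZ_pred : {pred X -> int} :=
  [pred f : X -> int | `[< continuous (f : X -> discrete_topology int) >]].

Lemma continuousZP (f : X -> int) :
  reflect (forall x, \forall y \near x, f y = f x) (f \in continuousZ_pred).
Proof.
apply: (iffP idP) => [/asboolP cf x|cf].
  exact: (cf x [set f x] (discrete_set1 (f x : discrete_topology int))).
apply/asboolP => x; apply/discrete_cvg; exact: cf.
Qed.

Lemma continuousZ_closed : zmod_closed continuousZ_pred.
Proof.
split; first by apply/continuousZP => x; near=> y.
move=> f g /continuousZP cf /continuousZP cg; apply/continuousZP => x.
by near=> y; congr (_ - _); near: y; [exact: cf | exact: cg].
Unshelve. all: by end_near. Qed.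
HB.instance Definition _ :=
  GRing.isZmodClosed.Build (X -> int) continuousZ_pred continuousZ_closed.

Record continuousZ := ContinuousZ {
  continuousZ_fun :> X -> int;
  _ : continuousZ_fun \in continuousZ_pred }.
HB.instance Definition _ := [isSub for continuousZ_fun].
HB.instance Definition _ := [Choice of continuousZ by <:].
HB.instance Definition _ := [SubChoice_isSubZmodule of continuousZ by <:].

Definition continuousZ_cone : set continuousZ := [set f | forall x, 0 <= f x].

Lemma continuousZ_cone0 : continuousZ_cone 0.
Proof. by move=> x. Qed.

Lemma continuousZ_coneD f g :
  continuousZ_cone f -> continuousZ_cone g -> continuousZ_cone (f + g).
Proof. by move=> pf pg x; exact: addr_ge0. Qed.

Definition continuousZ_ordGroup : ordGroup :=
  OrdGroup continuousZ_cone0 continuousZ_coneD.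

End ContinuousIntegerFunctions.

Section K0.
Variables (X : topologicalType) (T : continuousType X X).

Lemma continuousZ_comp_subproof (f : continuousZ X) :
  (f \o T : X -> int) \in @continuousZ_pred X.
Proof.
apply/asboolP => x; apply: continuous_comp; first exact: cts_fun.
by case: f => f /= /asboolP; apply.
Qed.
Definition continuousZ_comp (f : continuousZ X) : continuousZ X :=
  ContinuousZ (continuousZ_comp_subproof f).

Definition coboundary (f : continuousZ X) : continuousZ_ordGroup X :=
  f - continuousZ_comp f.

Lemma coboundary_additive : zmod_morphism coboundary.
Proof.
move=> f g; apply: val_inj; apply/funext => x.
change ((f x - g x) - (f (T x) - g (T x)) =
  (f x - f (T x)) - (g x - g (T x))).
by rewrite !opprB addrACA [RHS]addrACA; congr (_ + _); rewrite addrC.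
Qed.
HB.instance Definition _ :=
  GRing.isZmodMorphism.Build (continuousZ X) (continuousZ_ordGroup X)
    coboundary coboundary_additive.

Definition K0 : ordGroup := coker coboundary.

End K0.

Record substitution (A : Type) := Substitution {
  subst_word :> A -> seq A;
  subst_word_size : forall a, (0 < size (subst_word a))%N }.

Section Substitution.
Variables (A : finType) (sigma : substitution A).

Definition subst_ext (w : seq A) : seq A := flatten (map sigma w).
Definition subst_iter (n : nat) (a : A) : seq A := iter n subst_ext [:: a].

Definition in_language (w : seq A) : Prop := exists a n, infix w (subst_iter n a).

Definition subst_primitive : Prop :=
  exists n, forall a b, b \in subst_iter n a.

(* The words subst_iter p a are non-empty, so the defaults of head and last
   play no role, here and in sigmaQ_word below. *)
Definition subst_proper : Prop :=
  exists p l r, (0 < p)%N /\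
    forall a, head a (subst_iter p a) = l /\ last a (subst_iter p a) = r.

Definition subst_shift_set : set {ptws int -> discrete_topology A} :=
  [set x | forall (i : int) (n : nat),
    in_language [seq x (i + k%:Z) | k <- iota 0 n]].

Definition subst_aperiodic : Prop := infinite_set subst_shift_set.

Definition subst_space : topologicalType := set_type subst_shift_set.

Definition seq_shift (x : {ptws int -> discrete_topology A}) :
  {ptws int -> discrete_topology A} := fun i => x (i + 1).

Lemma seq_shift_subproof (x : subst_space) :
  seq_shift (set_val x) \in subst_shift_set.
Proof.
apply/mem_set => i n; have /= := set_valP x (i + 1) n.
by congr in_language; apply: eq_map => k; rewrite /seq_shift addrAC.
Qed.

Definition subst_shift_fun (x : subst_space) : subst_space :=
  SigSub (seq_shift_subproof x).

Lemma seq_shift_continuous : continuous seq_shift.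
Proof.
move=> x.
have FF : Filter (nbhs (seq_shift @ x)) by apply: fmap_filter; exact: nbhs_filter.
apply/cvg_sup => i U.
rewrite nbhsE => -[B [[V oV <-] Bx] BU].
apply: filterS BU _.
apply: (@proj_continuous int (fun=> discrete_topology A) (i + 1) x V).
by apply: open_nbhs_nbhs.
Qed.

Lemma subst_shift_continuous : continuous subst_shift_fun.
Proof.
apply: continuous_comp_initial => x.
apply: (@continuous_comp _ _ _ set_val seq_shift).
  exact: initial_continuous.
exact: seq_shift_continuous.
Qed.
HB.instance Definition _ :=
  isContinuous.Build subst_space subst_space subst_shift_fun
    subst_shift_continuous.

Definition subst_shift : continuousType subst_space subst_space := subst_shift_fun.

Definition AQ : Type :=
  {t : A * A * A | `[< in_language [:: t.1.1; t.1.2; t.2] >]}.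
HB.instance Definition _ := Finite.on AQ.
HB.instance Definition _ := SubType.on AQ.

(* The three-letter windows of w = a_m b_1 ... b_n c_1, where
   sigma(b) = b_1 ... b_n; the default b of nth is never reached. *)
Definition sigmaQ_word (t : A * A * A) : seq (A * A * A) :=
  let: (a, b, c) := t in
  let w := last a (sigma a) :: rcons (sigma b) (head c (sigma c)) in
  mkseq (fun i => (nth b w i, nth b w i.+1, nth b w i.+2)) (size (sigma b)).

Lemma subst_ext_cat u v : subst_ext (u ++ v) = subst_ext u ++ subst_ext v.
Proof. by rewrite /subst_ext map_cat flatten_cat. Qed.

Lemma in_language_infix u v : infix u v -> in_language v -> in_language u.
Proof. by move=> uv [a [n vn]]; exists a, n; exact: infix_trans uv vn. Qed.

Lemma in_language_subst w : in_language w -> in_language (subst_ext w).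
Proof.
move=> [a [n /infixP[u [v e]]]]; exists a, n.+1; apply/infixP.
exists (subst_ext u), (subst_ext v).
by rewrite -!subst_ext_cat -e.
Qed.

Lemma infix_nth3 (x : A) (w : seq A) (i : nat) : (i.+2 < size w)%N ->
  infix [:: nth x w i; nth x w i.+1; nth x w i.+2] w.
Proof.
move=> iw; apply/infixP; exists (take i w), (drop i.+3 w).
rewrite -[LHS](cat_take_drop i); congr cat.
rewrite (drop_nth x) ?(drop_nth x (n := i.+1)) ?(drop_nth x (n := i.+2)) //.
  by apply: ltn_trans iw.
by apply: ltn_trans iw; exact: ltnW.
Qed.

Lemma sigmaQ_word_AQ (t : AQ) :
  all (fun u => `[< in_language [:: u.1.1; u.1.2; u.2] >]) (sigmaQ_word (val t)).
Proof.
case: t => [[[a b] c] /= /asboolP abc]; apply/allP => _ /mapP[i + ->] /=.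
rewrite mem_iota add0n => /= ib; apply/asboolP.
set w := (last a (sigma a) :: rcons (sigma b) (head c (sigma c))).
have iw : (i.+2 < size w)%N by rewrite /w /= size_rcons !ltnS.
apply: in_language_infix (infix_nth3 b iw) _.
apply: in_language_infix (in_language_subst abc).
rewrite /subst_ext /= cats0 /w -cats1.
have := subst_word_size sigma a; have := subst_word_size sigma c.
case/lastP: (sigma a) => // sa x; case: (sigma c) => // y sc _ _.
rewrite last_rcons /= -cats1 -!catA /=; apply/infixP; exists sa, sc.
by rewrite /= -catA.
Qed.

(* insub never fails here: see val_sigmaQ. *)
Definition sigmaQ_fun (t : AQ) : seq AQ := pmap insub (sigmaQ_word (val t)).

Lemma val_sigmaQ (t : AQ) : map val (sigmaQ_fun t) = sigmaQ_word (val t).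
Proof.
rewrite /sigmaQ_fun pmap_filter; last by move=> u; exact: insubK.
apply/all_filterP; apply: sub_all (sigmaQ_word_AQ t) => u Pu.
by rewrite insubT.
Qed.

Lemma sigmaQ_size (t : AQ) : (0 < size (sigmaQ_fun t))%N.
Proof.
rewrite -(size_map val) val_sigmaQ; case: (val t) => [[a b] c] /=.
by rewrite size_mkseq subst_word_size.
Qed.

Definition sigmaQ : substitution AQ := Substitution sigmaQ_size.

Definition ZAQ_cone : set {ffun AQ -> int} := [set p | forall t, 0 <= p t].

Lemma ZAQ_cone0 : ZAQ_cone 0.
Proof. by move=> t; rewrite ffunE. Qed.

Lemma ZAQ_coneD p q : ZAQ_cone p -> ZAQ_cone q -> ZAQ_cone (p + q).
Proof. by move=> pp pq t; rewrite ffunE addr_ge0. Qed.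

Definition ZAQ : ordGroup := OrdGroup ZAQ_cone0 ZAQ_coneD.

Definition delta (phi : {ffun A * A -> int}) : ZAQ :=
  [ffun t : AQ => let: (a, b, c) := val t in phi (b, c) - phi (a, b)].

Lemma delta_additive : zmod_morphism delta.
Proof.
move=> f g; apply/ffunP => t; rewrite !ffunE; case: (val t) => [[a b] c].
by rewrite !ffunE !opprB addrACA [RHS]addrACA; congr (_ + _); rewrite addrC.
Qed.
HB.instance Definition _ :=
  GRing.isZmodMorphism.Build {ffun A * A -> int} ZAQ delta delta_additive.

Definition betaQ_fun (p : ZAQ) : ZAQ :=
  [ffun t : AQ => \sum_(u <- sigmaQ t) (p : {ffun AQ -> int}) u].

Lemma betaQ_additive : zmod_morphism betaQ_fun.
Proof.
move=> p q; apply/ffunP => t; rewrite !ffunE -sumrB.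
by apply: eq_bigr => u _; rewrite !ffunE.
Qed.
HB.instance Definition _ :=
  GRing.isZmodMorphism.Build ZAQ ZAQ betaQ_fun betaQ_additive.

Lemma betaQ_pos (p : ZAQ) : pos_cone p -> pos_cone (betaQ_fun p).
Proof. by move=> pp t; rewrite ffunE; apply: sumr_ge0. Qed.

Definition betaQ : ordHom ZAQ ZAQ := OrdHom betaQ_pos.

Lemma betaQ_delta phi : exists psi, betaQ (delta phi) = delta psi.
Proof.
exists [ffun ab => phi (last ab.1 (sigma ab.1), head ab.2 (sigma ab.2))].
apply/ffunP => t; rewrite !ffunE.
pose d u := phi (u.1.2, u.2) - phi (u.1.1, u.1.2).
transitivity (\sum_(u <- map val (sigmaQ t)) d u).
  rewrite big_map; apply: eq_bigr => u _; rewrite ffunE /d.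
  by case: (val u) => [[]].
rewrite val_sigmaQ; case: (val t) => [[a b] c]; rewrite !ffunE /=.
set w := (_ :: rcons _ _); rewrite big_map /= -[size _]subn0 -/(index_iota _ _).
pose e i := phi (nth b w i, nth b w i.+1).
rewrite (eq_bigr (fun i => e i.+1 - e i)) // telescope_sumr // /e /w /=.
have := subst_word_size sigma b; case/lastP: (sigma b) => // s x _.
rewrite size_rcons /= last_rcons !nth_rcons size_rcons ltnS leqnn ltnn eqxx.
rewrite ltnn eqxx ltnS; congr (_ - phi (_, _)).
by case: s => [|y s].
Qed.

Definition quotient_betaQ : ordHom (coker delta) (coker delta) :=
  coker_map betaQ_delta.

Definition limQ : ordGroup := ind_lim quotient_betaQ.

Definition dimension_group : ordGroup := K0 subst_shift.

End Substitution.

(* Main.v *)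
(* Along the fixed point x of a power tau of sigma, every level n cuts x into the
   blocks tau^n(x_i).  The class of a continuous f is sent to the sums of f over
   the level-n blocks; once these are long compared with the window of f, the
   sum over the block of x_i depends only on (x_{i-1}, x_i, x_{i+1}), and passing
   from n to n + 1 is beta^Q iterated.  Coboundaries give elements of delta.
   Conversely, when the block sums of f are in delta, the sums of f along the
   orbit are bounded, so f is a coboundary (Gottschalk-Hedlund).  That every
   function of triples comes from some f needs recognizability: the cuts of level
   n are visible in a bounded window (Mosse).  Instead of recovering the letter
   x_i itself from its block at level m + N, it is enough to recover tau^N(x_i),
   which the block determines as soon as N is large, uniformly in m. *)
From HB Require Import structures.
From mathcomp Require Import all_boot all_order all_algebra.
From mathcomp Require Import all_classical.
From mathcomp Require Import topology.
From mathcomp Require Import zify.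
Require Import Defs.

Set Implicit Arguments.
Unset Strict Implicit.
Unset Printing Implicit Defensive.

Import Order.TTheory GRing.Theory Num.Theory.
Local Open Scope ring_scope.

(** One orbit carries the whole argument: the shifts of [x] are dense in X_sigma, so continuous
    functions become functions on the integers that are local along [x], and the rest is arithmetic
    with cuts, offsets and sums. Blocks of the same level have lengths comparable up to the factor
    [M], whatever the level n; this makes the length [iter n c 1] of one block a unit, and the
    constants of the recognizability proof, counted in that unit, do not depend on the level. The
    obstacle to surjectivity is that distinct letters may have equal blocks, so a function of
    triples need not be readable from the blocks. Its image under a suitable power of beta^Q is, and
    it represents the same element of the limit at a later stage. Since [x] is fixed only by a power
    sigma^k, the two groups are compared at the copies of index [k * n], which are cofinal. *)

Lemma finite_uniform_bound (T : finType) (P : T -> nat -> Prop) :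
  (forall t N N', (N <= N')%N -> P t N -> P t N') ->
  (forall t, exists N, P t N) -> exists N, forall t, P t N.
Proof.
move=> Pmono /choice[F PF]; exists (\max_t F t) => t.
by apply: Pmono (PF t); exact: leq_bigmax.
Qed.

Lemma nat_pigeonhole (T : finType) (f : nat -> T) :
  exists u v, (u < v)%N /\ f u = f v.
Proof.
have /injectivePn[u [v uv fuv]] : ~~ injectiveb (fun i : 'I_#|T|.+1 => f i).
  by apply/negP => /injectiveP /leq_card; rewrite card_ord ltnn.
have [lt_uv|lt_vu|/val_inj eq_uv] := ltngtP u v; first by exists u, v.
  by exists v, u.
by rewrite eq_uv eqxx in uv.
Qed.

Lemma int_le_ind (P : int -> Prop) (u : int) :
  P u -> (forall v : int, u <= v -> P v -> P (v + 1)) -> forall v : int, u <= v -> P v.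
Proof.
move=> Pu PS v uv; have -> : v = u + (`|v - u|%N)%:Z by lia.
elim: `|v - u|%N => [|n IHn]; first by rewrite addr0.
by rewrite -addn1 PoszD addrA; apply: PS => //; lia.
Qed.

(** * Discrete primitives and increasing step functions on the integers *)

Section Primitive.
Implicit Types (g h : int -> int) (i u v s : int).

(** The antiderivative of [g] vanishing at 0. A sum of [g] over an interval is a difference of two
    of its values, whatever the signs of the endpoints. *)
Definition primitive g i : int :=
  match i with
  | Posz n => \sum_(k < n) g k%:Z
  | Negz n => - \sum_(k < n.+1) g (Negz k)
  end.

Lemma primitiveS g i : primitive g (i + 1) = primitive g i + g i.
Proof.
case: i => [n|[|n]].
- by rewrite -PoszD addn1 /= big_ord_recr.
- have -> : Negz 0 + 1 = 0 by lia.
  by rewrite /= big_ord0 big_ord_recr big_ord0 /= add0r addNr.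
have -> : Negz n.+1 + 1 = Negz n by lia.
by rewrite /= [in RHS]big_ord_recr /= opprD addrNK.
Qed.

Lemma primitive_unique g h :
  (forall i : int, h (i + 1) = h i + g i) ->
  forall u v : int, primitive g v - primitive g u = h v - h u.
Proof.
move=> hS u v; wlog uv : u v / u <= v.
  by move=> H; have [/H //|/ltW/H] := leP u v; lia.
move: v uv; apply: int_le_ind => [|v uv IH]; first by rewrite !subrr.
by rewrite primitiveS hS; lia.
Qed.

Lemma primitive_ext g h u v s :
  (forall l : int, u <= l -> l < v -> g l = h (l + s)) -> u <= v ->
  primitive g v - primitive g u = primitive h (v + s) - primitive h (u + s).
Proof.
move=> gh uv; move: v uv gh; apply: int_le_ind => [|v uv IH] gh.
  by rewrite !subrr.
have -> : v + 1 + s = v + s + 1 by lia.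
rewrite !primitiveS gh; [|lia..].
have {}IH := IH (fun l ul lv => gh l ul ltac:(lia)).
lia.
Qed.

End Primitive.

Section StepBounds.
Variables (f : int -> int) (m : int).

Lemma step_lower : (forall i : int, f i + m <= f (i + 1)) ->
  forall u v : int, u <= v -> f u + (v - u) * m <= f v.
Proof.
move=> fm u; apply: int_le_ind => [|v uv IH]; first by rewrite subrr mul0r addr0.
by have := fm v; lia.
Qed.

Lemma step_upper : (forall i : int, f (i + 1) <= f i + m) ->
  forall u v : int, u <= v -> f v <= f u + (v - u) * m.
Proof.
move=> fm u; apply: int_le_ind => [|v uv IH]; first by rewrite subrr mul0r addr0.
by have := fm v; lia.
Qed.

End StepBounds.

Lemma int_constant (f : int -> int) :
  (forall i : int, f (i + 1) = f i) -> forall i : int, f i = f 0.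
Proof.
move=> fS i; have [i0|/ltW i0] := leP 0 i.
  by move: i i0; apply: int_le_ind => // v _ <-; rewrite fS.
by move: 0 i0; apply: int_le_ind => // v _ ->; rewrite fS.
Qed.

Lemma step_cover (f : int -> int) : (forall i : int, f i + 1 <= f (i + 1)) ->
  forall y : int, exists i : int, f i <= y < f (i + 1).
Proof.
move=> /step_lower fl y; pose e := - `|f 0 - y|.
have fe : f e <= y by have := fl e 0 ltac:(lia); lia.
have ex : exists n : nat, y < f (e + n%:Z + 1).
  exists `|y - f e|%N; have := fl e (e + (`|y - f e|%N)%:Z + 1) ltac:(lia); lia.
case: (ex_minnP ex) => n yn nmin; exists (e + n%:Z); rewrite yn andbT.
case: n nmin {yn} => [|n] nmin; first by rewrite addr0.
rewrite leNgt; apply/negP => yn; suff : (n < n)%N by rewrite ltnn.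
by apply: nmin; move: yn; congr (_ < f _); lia.
Qed.

(** * Cut positions of a fixed point *)

Definition shift_agree (A : Type) (x : int -> A) (s u v : int) : Prop :=
  forall l : int, u <= l -> l < v -> x (l + s) = x l.

(** What continuity becomes along the orbit: the local functions with integer values are the
    restrictions of continuous functions on X_sigma ([orbit_values_local], [local_extension]). *)
Definition local_on (A : Type) (x : int -> A) (T : Type) (g : int -> T) : Prop :=
  exists L : int, forall y s : int,
    shift_agree x s (y - L) (y + L + 1) -> g (y + s) = g y.

(* x is a two-sided fixed point of a substitution theta, and c i is the place
   where the block theta(x i) starts in x = ... theta(x (-1)) . theta(x 0) ... *)
Record fixed_point (A : Type) (x : int -> A) (c : int -> int) (M : int) : Prop :=
  FixedPoint {
  fp0 : c 0 = 0;
  fp_grow : forall i : int, c i + 2 <= c (i + 1);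
  fp_bound : forall i : int, c (i + 1) <= c i + M;
  fp_size : forall i j : int, x i = x j -> c (i + 1) - c i = c (j + 1) - c j;
  fp_copy : forall i j r : int, x i = x j -> 0 <= r -> r < c (i + 1) - c i ->
    x (c j + r) = x (c i + r);
  fp_letters : forall i j : int, exists r : int,
    [/\ c i <= r, r < c (i + 1) & x r = x j];
  fp_pair : exists e : int, [/\ 1 <= e, x (e - 1) = x (- 1) & x e = x 0];
  fp_aperiodic : forall t : int, 0 < t -> exists y : int, x (y + t) <> x y }.

Section Cuts.
Variables (A : finType) (x : int -> A) (c : int -> int) (M : int).
Hypothesis xc : fixed_point x c M.

Local Notation cut n := (iter n c).
Local Notation agree := (shift_agree x).

Lemma agree_sub s u v u' v' : u <= u' -> v' <= v -> agree s u v -> agree s u' v'.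
Proof. by move=> uu vv h l ul lv; apply: h; lia. Qed.

Lemma agree_opp s u v : agree s u v -> agree (- s) (u + s) (v + s).
Proof.
move=> h l ul lv; rewrite -(h (l + - s)); [|lia..].
by congr x; lia.
Qed.

Lemma agree_trans s s' u v :
  agree s u v -> agree s' (u + s) (v + s) -> agree (s + s') u v.
Proof.
move=> h h' l ul lv; rewrite -(h l ul lv) -(h' (l + s)); [|lia..].
by congr x; lia.
Qed.

Lemma bound_ge2 : 2 <= M.
Proof. by have := fp_grow xc 0; have := fp_bound xc 0; lia. Qed.

Lemma cut0 n : cut n 0 = 0.
Proof. by elim: n => //= n ->; exact: fp0 xc. Qed.

Lemma cut_grow n (i : int) : cut n i + (n%:Z + 1) <= cut n (i + 1).
Proof.
elim: n => [|n IHn]; first by rewrite /=; lia.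
rewrite !iterS; have := step_lower (fp_grow xc) (u := cut n i) (v := cut n (i + 1)).
lia.
Qed.

Lemma cut_step n (i : int) : cut n i + 1 <= cut n (i + 1).
Proof. by have := cut_grow n i; lia. Qed.

Lemma cut_bound n (i : int) : cut n (i + 1) <= cut n i + M ^+ n.
Proof.
have M2 := bound_ge2; elim: n => [|n IHn]; first by rewrite expr0.
rewrite !iterS; have := step_upper (fp_bound xc) (u := cut n i) (v := cut n (i + 1)).
have := cut_step n i; rewrite exprS; nia.
Qed.

Lemma cut_diff n (u v : int) : u <= v -> v - u <= cut n v - cut n u.
Proof. by move/(step_lower (cut_step n)); lia. Qed.

Lemma cut_le n (u v : int) : u <= v -> cut n u <= cut n v.
Proof. by move=> uv; have := cut_diff n uv; lia. Qed.

Lemma cut_lt n (u v : int) : u < v -> cut n u < cut n v.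
Proof. by move=> uv; have := @cut_diff n u v ltac:(lia); lia. Qed.

Lemma cut_lt_inv n (u v : int) : cut n u < cut n v -> u < v.
Proof. by move=> uv; rewrite ltNge; apply/negP => /(cut_le n); lia. Qed.

Lemma cut_le_inv n (u v : int) : cut n u <= cut n v -> u <= v.
Proof. by move=> uv; rewrite leNgt; apply/negP => /(cut_lt n); lia. Qed.

Lemma cut_inj n : injective (cut n).
Proof.
move=> u v e; have := @cut_le_inv n u v; have := @cut_le_inv n v u.
by rewrite e lexx => /(_ isT) vu /(_ isT) uv; lia.
Qed.

Lemma cut_cover n (y : int) : exists i : int, cut n i <= y < cut n (i + 1).
Proof. by apply: step_cover; exact: cut_step. Qed.

(** Equal letters have blocks of equal length, so all cuts over the stretch move by one and the same
    offset, and [fp_copy] matches the blocks letter by letter. *)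
Lemma agree_cut1 s u v : agree s u v -> u <= v ->
  (forall w : int, u <= w -> w <= v -> c (w + s) - c w = c (u + s) - c u) /\
  agree (c (u + s) - c u) (c u) (c v).
Proof.
move=> h uv.
have sh (w : int) : u <= w -> w <= v -> c (w + s) - c w = c (u + s) - c u.
  move: w; apply: int_le_ind => [//|w uw IH wv].
  have e : x (w + s) = x w by apply: h; lia.
  have := fp_size xc e; have -> : w + 1 + s = w + s + 1 by lia.
  by have := IH ltac:(lia); lia.
split=> // l ul lv; have [w /andP[wl lw]] := cut_cover 1 l.
rewrite /= in wl lw.
have uw : u <= w by have := @cut_lt_inv 1 u (w + 1); rewrite /=; lia.
have wv : w < v by have := @cut_lt_inv 1 w v; rewrite /=; lia.
have e : x (w + s) = x w by apply: h.
have := @fp_copy _ _ _ _ xc w (w + s) (l - c w) (esym e) ltac:(lia) ltac:(lia).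
have -> : c w + (l - c w) = l by lia.
move=> <-; congr x.
by have := sh w uw ltac:(lia); lia.
Qed.

Lemma agree_cut n s u v : agree s u v -> u <= v -> exists s' : int,
  (forall w : int, u <= w -> w <= v -> cut n (w + s) = cut n w + s') /\
  agree s' (cut n u) (cut n v).
Proof.
move=> h uv; elim: n => [|n [s' [sh h']]]; first by exists s.
have [sh1 h1] := agree_cut1 h' (cut_le n uv).
eexists; split; last exact: h1.
move=> w uw wv; rewrite !iterS sh //.
by have := sh1 (cut n w) (cut_le n uw) (cut_le n wv); lia.
Qed.

Definition is_cut n (y : int) : Prop := exists i : int, y = cut n i.

(** A level-n offset also respects the finer cuts of level [m]: apply the substitution [n - m]
    times, then [m] more times. The equation at [cut n u] identifies [s'] with the offset so
    obtained. *)
Lemma agree_is_cut (n m : nat) (s u v s' y : int) : (m <= n)%N -> agree s u v ->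
  cut n (u + s) = cut n u + s' -> cut n u <= y -> y < cut n v ->
  is_cut m y -> is_cut m (y + s').
Proof.
move=> mn h e uy yv [i yi].
have uv : u <= v by apply: ltW; apply: (@cut_lt_inv n); lia.
have [t [sht ht]] := agree_cut (n - m) h uv.
have [t' [sht' ht']] := agree_cut m ht (cut_le _ uv).
have E w : cut n w = cut m (cut (n - m) w) by rewrite -iterD subnKC.
have -> : s' = t'.
  by move: e; rewrite !E (sht u) // (sht' _ (lexx _) (cut_le _ uv)) => /addrI.
exists (i + t); rewrite sht' -?yi //.
  by apply: (@cut_le_inv m); rewrite -yi -E.
by apply: (@cut_le_inv m); rewrite -yi -E; lia.
Qed.

(** The letter [x i] occurs in the image of [x j], so its level-n block fits into the level-(n + 1)
    block of [x j], which is at most [M] times as long as the level-n one. *)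
Lemma block_ratio n (i j : int) :
  cut n (i + 1) - cut n i <= M * (cut n (j + 1) - cut n j).
Proof.
have M2 := bound_ge2.
have [r [ri rj e]] := fp_letters xc j i.
have h : agree (i - r) r (r + 1).
  move=> l rl lr; have -> : l = r by lia.
  by rewrite e; congr x; lia.
have [s' [sh _]] := agree_cut n h ltac:(lia).
have := sh r ltac:(lia) ltac:(lia); have := sh (r + 1) ltac:(lia) ltac:(lia).
have -> : r + 1 + (i - r) = i + 1 by lia.
have -> : r + (i - r) = i by lia.
have := cut_le n ri; have := @cut_le n (r + 1) (c (j + 1)) ltac:(lia).
have := step_upper (fp_bound xc) (@cut_le n j (j + 1) ltac:(lia)).
rewrite -!iterS !iterSr; lia.
Qed.

Lemma unit_gt0 n : n%:Z + 1 <= cut n 1.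
Proof. by have := cut_grow n 0; rewrite add0r cut0 add0r. Qed.

Lemma span_upper n (u v : int) : u <= v ->
  cut n v <= cut n u + (v - u) * (M * cut n 1).
Proof.
apply: step_upper => i; have := block_ratio n i 0.
by rewrite add0r cut0 subr0; lia.
Qed.

Lemma span_ge_block n (i u v : int) : u <= v ->
  (v - u) * (cut n (i + 1) - cut n i) <= M * (cut n v - cut n u).
Proof.
have st (j : int) : M * cut n j + (cut n (i + 1) - cut n i) <= M * cut n (j + 1).
  by have := block_ratio n i j; lia.
by move/(@step_lower (fun j => M * cut n j) _ st); lia.
Qed.

Lemma span_lower n (u v : int) : u <= v ->
  (v - u) * cut n 1 <= M * (cut n v - cut n u).
Proof. by move/(span_ge_block n 0); rewrite add0r cut0 subr0. Qed.

Lemma letter_recurrence (i z : int) :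
  exists l : int, [/\ z <= l, l < z + (2 * M) & x l = x i].
Proof.
have [e /andP[ez ze]] := cut_cover 1 z; rewrite /= in ez ze.
have [r [er re xr]] := fp_letters xc (e + 1) i.
exists r; split=> //; first by lia.
by have := fp_bound xc e; have := fp_bound xc (e + 1); lia.
Qed.

Lemma cut_recurrence n (z : int) : exists l : int,
  [/\ z <= cut n l, cut n (l + 1) <= z + ((2 * M + 1) * M ^+ n) & x l = x 0].
Proof.
have [e /andP[ez ze]] := cut_cover n z.
have [l [el le xl]] := letter_recurrence 0 (e + 1); exists l; split=> //.
  by have := cut_le n el; lia.
have M2 := bound_ge2.
have := @cut_le n (l + 1) (e + (2 * M + 1)) ltac:(lia).
by have := step_upper (cut_bound n) (u := e) (v := e + (2 * M + 1)) ltac:(lia); lia.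
Qed.

(* The window lies inside the level-n blocks of x (-1) and x 0 for some n; by
   fp_pair these two blocks recur inside one block of x 0 at some level m, and
   those blocks occur with bounded gaps. *)
Lemma window_recurrence (i n : int) : 0 <= n -> exists N : nat, forall z : int,
  exists s : int, [/\ z <= i + s, i + s + n <= z + N%:Z & agree s i (i + n)].
Proof.
move=> n0; pose j := `|(`|i| + n)%R|%N.
have lo : cut j (- 1) <= i.
  by have := cut_grow j (- 1); rewrite addNr cut0; lia.
have hi : i + n <= cut j 1 by have := unit_gt0 j; lia.
have [e [e1 xe xe']] := fp_pair xc.
have h : agree e (- 1) 1.
  move=> l l1 l2.
  have [->|->] : l = - 1 \/ l = 0 by lia.
    by rewrite -xe; congr x; lia.
  by rewrite -xe'; congr x; lia.
have [s' [sh hs]] := agree_cut j h ltac:(lia).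
have E1 := sh (- 1) ltac:(lia) ltac:(lia).
have p1 : 0 <= cut j (- 1) + s' by rewrite -E1 -(cut0 j); apply: cut_le; lia.
pose m := `|(cut j 1 + s')%R|%N.
have p2 : cut j 1 + s' <= cut m 1 by have := unit_gt0 m; lia.
pose N := (2 * M + 1) * M ^+ m; exists `|N|%N => z.
have [l [zl lz xl]] := cut_recurrence m z.
have h0 : agree l 0 1.
  by move=> l1 *; rewrite (_ : l1 = 0); [rewrite -xl; congr x|]; lia.
have [s'' [sh' hs']] := agree_cut m h0 ltac:(lia).
have := sh' 0 ltac:(lia) ltac:(lia); have := sh' 1 ltac:(lia) ltac:(lia).
rewrite cut0 !add0r => E3 E4.
have e1l : 1 + l = l + 1 by lia.
rewrite e1l in E4 E3.
exists (s' + s''); split; [by lia | by rewrite -/N in lz; lia |].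
apply: agree_trans (agree_sub lo hi hs) _.
by apply: agree_sub hs'; rewrite ?cut0; lia.
Qed.

(** There are finitely many words of length [n], and the gap bound found for one occurrence of a
    word serves all its occurrences. *)
Lemma uniform_recurrence (n : int) : 0 <= n -> exists N : int, forall i z : int,
  exists s : int, [/\ z <= i + s, i + s + n <= z + N & agree s i (i + n)].
Proof.
move=> n0.
pose P (w : {ffun 'I_`|n| -> A}) (N : nat) := forall i : int,
  (forall k : 'I_`|n|, x (i + k%:Z) = w k) -> forall z : int, exists s : int,
  [/\ z <= i + s, i + s + n <= z + N%:Z & agree s i (i + n)].
have [|w|N PN] := finite_uniform_bound (P := P).
- move=> w N N' NN' PN i wi z; have [s [zs sz h]] := PN i wi z.
  by exists s; split=> //; lia.
- have [[i wi]|no] := pselect (exists i : int,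
    forall k : 'I_`|n|, x (i + k%:Z) = w k); last first.
    by exists 0%N => i wi; case: no; exists i.
  have [N PN] := window_recurrence i n0; exists N => i' wi' z.
  have h : agree (i - i') i' (i' + n).
    move=> l l1 l2; have ln : (`|l - i'| < `|n|)%N by lia.
    have := wi (Ordinal ln); rewrite -(wi' (Ordinal ln)) /=.
    have -> : i' + (`|l - i'|%N)%:Z = l by lia.
    by move=> <-; congr x; lia.
  have [s [zs sz hs]] := PN z; exists (i - i' + s).
  split; [by lia | by lia |].
  by apply: agree_trans h _; apply: agree_sub hs; lia.
exists N%:Z => i z.
by apply: (PN [ffun k : 'I_`|n| => x (i + k%:Z)]) => k; rewrite ffunE.
Qed.

(* The letters at distance t in x both lie in one block sequence of bounded
   length, which recurs inside the periodic stretch: so x itself would have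
   period t. *)
Lemma no_long_period (B : int) : 0 <= B -> exists2 K : int, 0 < K &
  forall n (t z : int), 0 < t -> t <= B * cut n 1 ->
    ~ agree t z (z + K * cut n 1).
Proof.
move=> B0; have M2 := bound_ge2.
(* By [span_lower], [B * M] blocks of level [n] measure at least [B * cut n 1], hence at least [t];
   one more block contains [y]. *)
have [N PN] := @uniform_recurrence (B * M + 1) ltac:(nia).
have N0 : 0 <= N by have [s [? ? _]] := PN 0 0; nia.
(* The recurrence is found within [N + 1] blocks of level [n], and these measure at most
   [(N + 1) * M * cut n 1]. *)
exists ((N + 1) * M) => [|n t z t0 tB h]; first by nia.
have [y] := fp_aperiodic xc t0; apply.
have u0 := unit_gt0 n.
have [i /andP[iy yi]] := cut_cover n y.
have ty : y + t < cut n (i + (B * M + 1)).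
  have := @span_lower n (i + 1) (i + (B * M + 1)) ltac:(nia).
  have -> : i + (B * M + 1) - (i + 1) = B * M by lia.
  by nia.
have [e /andP[ez ze]] := cut_cover n z.
have [s [es se hs]] := PN i (e + 1).
have [s' [sh hs']] := agree_cut n hs ltac:(nia).
have E1 := sh i ltac:(lia) ltac:(nia).
have E2 := sh (i + (B * M + 1)) ltac:(nia) ltac:(lia).
have q1 := cut_le n es.
have q2 : cut n (i + (B * M + 1) + s) <= cut n (e + 1 + N) by apply: cut_le; lia.
have q3 := @span_upper n e (e + 1 + N) ltac:(lia).
have q4 : (e + 1 + N - e) * (M * cut n 1) = (N + 1) * M * cut n 1 by lia.
have q5 : cut n i <= cut n (i + (B * M + 1)) by apply: cut_le; nia.
rewrite -(hs' (y + t)) -?(hs' y); [|lia..].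
rewrite -(h (y + s')); [|lia..].
by congr x; lia.
Qed.

End Cuts.

(** * Recognizability *)

(** A finite function, so that the windows of radius [r] form a finite type and can be fed to the
    pigeonhole principle. *)
Definition window (A : finType) (x : int -> A) (r : nat) (i : int) :
  {ffun 'I_(r + r) -> A} := [ffun k : 'I_(r + r) => x (i - r%:Z + k%:Z)].

Section Recognizability.
Variables (A : finType) (x : int -> A) (c : int -> int) (M : int).
Hypothesis xc : fixed_point x c M.

Local Notation cut n := (iter n c).
Local Notation agree := (shift_agree x).

Lemma window_agree r i j : window x r i = window x r j ->
  agree (j - i) (i - r%:Z) (i + r%:Z).
Proof.
move=> /ffunP w l l1 l2.
have lr : (`|(l - (i - r%:Z))%R| < r + r)%N by lia.
have := w (Ordinal lr); rewrite !ffunE /= => e.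
have -> : l + (j - i) = j - r%:Z + (`|(l - (i - r%:Z))%R|%N)%:Z by lia.
by rewrite -e; congr x; lia.
Qed.

(** The block of [i] starts less than its own length before [y], and by [span_ge_block] the [M]
    blocks preceding that of [j] are together at least that long. *)
Lemma offset_bound n (i j y s : int) :
  cut n i <= y < cut n (i + 1) -> cut n j <= y + s < cut n (j + 1) ->
  cut n (j - M) <= cut n i + s <= cut n (j + 1).
Proof.
have M2 := bound_ge2 xc.
have := span_ge_block xc n i (u := j - M) (v := j) ltac:(lia).
have -> : j - (j - M) = M by lia.
by rewrite ler_pM2l; lia.
Qed.

(* If a level-n cut y looked on a large window like a non-cut y + s, for windows
   growing with the level p, two levels p < q would show the same level-p and
   level-q configurations.  The overlap at level q and the image under level
   q - p of the overlap at level p then have the same offset, since otherwise x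
   would have a long period; but the second one respects cuts. *)
Lemma recognizability n : local_on x (is_cut c n).
Proof.
suff [L PL] : exists L : int, forall y s : int,
    agree s (y - L) (y + L + 1) -> is_cut c n y -> is_cut c n (y + s).
  exists L => y s h; apply/propext; split; last exact: PL.
  have h' : agree (- s) (y + s - L) (y + s + L + 1).
    by apply: agree_sub (agree_opp h); lia.
  by move/(PL _ _ h'); have -> : y + s + - s = y by lia.
apply: contrapT => /forallNP bad.
have M2 := bound_ge2 xc.
(* Each of the two offsets compared in [same] sends [cut q i1] to a place at most [M * M * lam]
   before and at most [M * lam] after [cut q j], so they differ by at most [(M * M + M) * lam]. *)
have [K1 K10 PK1] := @no_long_period _ x c M xc (M * M + M) ltac:(nia).
(* With this [K], the blocks around [i1] cover a stretch of length [K1 * lam], too long for a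
   period. With [K'], the blocks around [j1] contain the image of that stretch: [K * M * lam] bounds
   half of it and [M * M * lam] its displacement. *)
pose K := `|(M * K1)%R|%N.
pose K' := `|(M * (K%:Z * M + M * M))%R|%N.
have KE : K%:Z = M * K1 by rewrite /K; nia.
have K'E : K'%:Z = M * (K%:Z * M + M * M) by rewrite /K'; nia.
clearbody K K'.
(* Multiples of [n], so that the levels of two different indices are at least [n] apart; this gives
   [npq] below. *)
pose lev u := (n * u)%N.
have conf u : exists w : int * int * int * int,
    let: (y, s, i, i') := w in let p := lev u in
    [/\ is_cut c n y, ~ is_cut c n (y + s),
        cut p i <= y < cut p (i + 1), cut p i' <= y + s < cut p (i' + 1) &
        agree s (cut p (i - K%:Z)) (cut p (i + K%:Z))].
  set p := lev u.
  have /existsNP[y /existsNP[s /not_implyP[h /not_implyP[yn ysn]]]] :=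
    bad ((K%:Z + 1) * M ^+ p).
  have [i iy] := cut_cover xc p y; have [i' iy'] := cut_cover xc p (y + s).
  exists (y, s, i, i'); split=> //; apply: agree_sub h.
    have := step_upper (cut_bound xc p) (u := i - K%:Z) (v := i + 1) ltac:(lia).
    by move: iy; lia.
  have := step_upper (cut_bound xc p) (u := i) (v := i + K%:Z) ltac:(lia).
  have Mp : 0 <= M ^+ p by apply: exprn_ge0; lia.
  by move: iy; lia.
have {conf} [w conf] := choice conf.
have [u [v [uv]]] := nat_pigeonhole (fun u =>
  let: (y, s, i, i') := w u in (window x K i, window x K' i')).
move: (conf u) (conf v); clear conf.
case: (w u) (w v) => [[[y1 s1] i1] j1] [[[y s] i] j].
set p := lev u; set q := lev v => -[_ _ iy1 jy1 h1] [yn ysn iy jy h] [].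
move=> /window_agree hi /window_agree hj; apply: ysn.
have npq : (n <= q - p)%N.
  by rewrite /p /q /lev -mulnBr leq_pmulr // subn_gt0.
have pq : (p <= q)%N by rewrite /p /q /lev leq_mul // ltnW.
have E w' : cut q w' = cut (q - p) (cut p w') by rewrite -iterD subnK.
clearbody p q.
have uvp : cut p (i1 - K%:Z) <= cut p (i1 + K%:Z) by apply: (cut_le xc); lia.
(* A square of offsets at level [q]: [s'] goes from around [i1] to around [j1] and comes from level
   [p], [s] goes from [i] to [j], and [t1], [t2] lead from [i1] to [i] and from [j1] to [j]. The
   claim [same] says that it commutes. *)
have [s' [sh h']] := agree_cut xc (q - p) h1 uvp.
rewrite -!E in h'.
have [t1 [sh1 ht1]] := agree_cut xc q hi ltac:(lia).
have [t2 [sh2 ht2]] := agree_cut xc q hj ltac:(lia).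
have off := offset_bound iy jy.
have off1 : cut q (j1 - M) <= cut q i1 + s' <= cut q (j1 + 1).
  have /andP[o1 o2] := offset_bound iy1 jy1.
  rewrite !E -sh; [|by apply: (cut_le xc); lia..].
  by rewrite !(cut_le xc (q - p)).
have := unit_gt0 xc q; set lam := cut q 1 => lam0.
have i1i : i1 + (i - i1) = i by lia.
have j1j : j1 + (j - j1) = j by lia.
have Ei : cut q i = cut q i1 + t1 by rewrite -sh1 ?i1i //; lia.
have Ej : cut q j = cut q j1 + t2 by rewrite -sh2 ?j1j //; lia.
have EiN : cut q (i - K%:Z) = cut q (i1 - K%:Z) + t1.
  by rewrite -sh1 ?lexx //; [congr (cut q _)|]; lia.
have EiP : cut q (i + K%:Z) = cut q (i1 + K%:Z) + t1.
  by rewrite -sh1 ?lexx //; [congr (cut q _)|]; lia.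
rewrite EiN EiP in h.
have cancel (X Y : int) : M * X <= M * Y -> X <= Y by rewrite ler_pM2l //; lia.
have r1 : cut q i1 - cut q (i1 - K%:Z) <= K%:Z * M * lam.
  by have := span_upper xc q (u := i1 - K%:Z) (v := i1) ltac:(lia); lia.
have r2 : cut q (i1 + K%:Z) - cut q i1 <= K%:Z * M * lam.
  by have := span_upper xc q (u := i1) (v := i1 + K%:Z) ltac:(lia); lia.
have r3 : K1 * lam <= cut q (i1 + K%:Z) - cut q (i1 - K%:Z).
  apply: cancel.
  have := span_lower xc q (u := i1 - K%:Z) (v := i1 + K%:Z) ltac:(lia).
  have -> : i1 + K%:Z - (i1 - K%:Z) = M * K1 + M * K1 by lia.
  have : 0 <= M * K1 * lam by rewrite !mulr_ge0; lia.
  by rewrite -/lam; lia.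
have r4 : (K%:Z * M + M * M) * lam <= cut q j1 - cut q (j1 - K'%:Z).
  apply: cancel.
  have := span_lower xc q (u := j1 - K'%:Z) (v := j1) ltac:(lia).
  have -> : j1 - (j1 - K'%:Z) = M * (K%:Z * M + M * M) by lia.
  by rewrite -/lam; lia.
have r5 : (K%:Z * M + M * M) * lam <= cut q (j1 + K'%:Z) - cut q j1.
  apply: cancel.
  have := span_lower xc q (u := j1) (v := j1 + K'%:Z) ltac:(lia).
  have -> : j1 + K'%:Z - j1 = M * (K%:Z * M + M * M) by lia.
  by rewrite -/lam; lia.
have r6 : cut q j1 - cut q (j1 - M) <= M * M * lam.
  by have := span_upper xc q (u := j1 - M) (v := j1) ltac:(lia); lia.
have r7 : cut q (j1 + 1) - cut q j1 <= M * lam.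
  by have := span_upper xc q (u := j1) (v := j1 + 1) ltac:(lia); lia.
have r8 : cut q j - cut q (j - M) <= M * M * lam.
  by have := span_upper xc q (u := j - M) (v := j) ltac:(lia); lia.
have r9 : cut q (j + 1) - cut q j <= M * lam.
  by have := span_upper xc q (u := j) (v := j + 1) ltac:(lia); lia.
have r10 : M * lam <= M * M * lam by nia.
have overlap l : cut q (i1 - K%:Z) <= l -> l < cut q (i1 + K%:Z) ->
    x (l + s' + t2) = x (l + t1 + s).
  by move=> l1 l2; rewrite ht2 ?h' ?h ?ht1 //; lia.
have PKq := PK1 q; rewrite -/lam in PKq.
have same : t1 + s = s' + t2.
  have [lt|gt|//] := ltgtP (t1 + s) (s' + t2).
    have [] := PKq (s' + t2 - (t1 + s)) (cut q (i1 - K%:Z) + t1 + s); [lia..|].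
    move=> l l1 l2; have := overlap (l - t1 - s) ltac:(lia) ltac:(lia).
    have -> : l - t1 - s + s' + t2 = l + (s' + t2 - (t1 + s)) by lia.
    by move=> ->; congr x; lia.
  have [] := PKq (t1 + s - (s' + t2)) (cut q (i1 - K%:Z) + s' + t2); [lia..|].
  move=> l l1 l2; have := overlap (l - t2 - s') ltac:(lia) ltac:(lia).
  have -> : l - t2 - s' + t1 + s = l + (t1 + s - (s' + t2)) by lia.
  by move=> <-; congr x; lia.
have y_lo : cut q (i1 - K%:Z) <= y - t1.
  by have := cut_le xc q (u := i1 - K%:Z) (v := i1) ltac:(lia); lia.
have y_hi : y - t1 < cut q (i1 + K%:Z).
  by have := cut_le xc q (u := i + 1) (v := i + K%:Z) ltac:(nia); lia.
(* Go from [y] to [y + s] the other way round the square. Each side respects level-n cuts: [t1] and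
   [t2] because [n <= q], and [s'] because [n <= q - p]. *)
have c1 : is_cut c n (y - t1).
  apply: (agree_is_cut xc (n := q) _ (agree_opp hi) _ _ _ yn).
  - exact: leq_trans npq (leq_subr _ _).
  - have -> : i1 - K%:Z + (i - i1) + - (i - i1) = i1 - K%:Z by lia.
    have -> : i1 - K%:Z + (i - i1) = i - K%:Z by lia.
    by lia.
  - have -> : i1 - K%:Z + (i - i1) = i - K%:Z by lia.
    by lia.
  - have -> : i1 + K%:Z + (i - i1) = i + K%:Z by lia.
    by lia.
have c2 : is_cut c n (y - t1 + s').
  by apply: (agree_is_cut xc npq h1 _ _ _ c1); rewrite -?E // E sh.
have c3 : is_cut c n (y - t1 + s' + t2).
  apply: (agree_is_cut xc _ hj _ _ _ c2).
  - exact: leq_trans npq (leq_subr _ _).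
  - by apply: sh2; lia.
  - by lia.
  - by lia.
by have -> : y + s = y - t1 + s' + t2 by lia.
Qed.
End Recognizability.

(** * Local functions and their block sums *)

Section Towers.
Variables (A : finType) (x : int -> A) (c : int -> int) (M : int).
Hypothesis xc : fixed_point x c M.

Local Notation cut n := (iter n c).
Local Notation agree := (shift_agree x).

Definition block_sum n (g : int -> int) (i : int) : int :=
  primitive g (cut n (i + 1)) - primitive g (cut n i).

Lemma primitive_shift (g h : int -> int) (u v s : int) :
  (forall i : int, h (i + 1) = h i + g i) -> u <= v ->
  (forall l : int, u <= l -> l < v -> g (l + s) = g l) ->
  h (v + s) - h (u + s) = h v - h u.
Proof.
move=> hS uv gs; rewrite -!(primitive_unique hS); apply: esym.
by apply: primitive_ext => // l ul lv; rewrite gs.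
Qed.

Lemma max_attained (T : Type) (f : T -> int) (t : T) (B : int) :
  (forall t', f t' <= B) -> exists t0, forall t', f t' <= f t0.
Proof.
move=> fB.
have ex : exists n : nat, `[< exists t', B - f t' = n%:Z >].
  by exists `|(B - f t)%R|%N; apply/asboolP; exists t; have := fB t; lia.
case: (ex_minnP ex) => n /asboolP[t0 t0n] nmin; exists t0 => t'.
have := nmin `|(B - f t')%R|%N; have := fB t'.
move=> h /(_ _); have : `[< exists t'', B - f t'' = `|(B - f t')%R|%N :> int >].
  by apply/asboolP; exists t'; lia.
by move=> h' /(_ h'); lia.
Qed.

(* A window showing both a maximum and a minimum of h recurs with bounded gaps
   and forces h to take the same two values again at each recurrence; so h is
   known near every place, and g tells the rest. *)
Lemma bounded_primitive_local (g h : int -> int) (B : int) :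
  (forall i : int, h (i + 1) = h i + g i) -> (forall i : int, `|h i| <= B) ->
  local_on x g -> local_on x h.
Proof.
move=> hS hB [L gL].
have [a ha] := @max_attained _ h 0 B (fun i => ltac:(have := hB i; lia)).
have [b hb] := @max_attained _ (fun i => - h i) 0 B (fun i => ltac:(have := hB i; lia)).
pose lo := Num.min a b; pose hi := Num.max a b.
have [N PN] := uniform_recurrence xc (n := hi - lo + 2 * `|L| + 1) ltac:(lia).
have recur s : agree s (lo - `|L|) (hi + `|L| + 1) -> h (a + s) = h a.
  move=> hs; have gs (l : int) : lo <= l -> l < hi -> g (l + s) = g l.
    by move=> l1 l2; apply: gL; apply: agree_sub hs; lia.
  have := primitive_shift (s := s) hS (u := lo) (v := hi) ltac:(lia) gs.
  have := ha (a + s); have := hb (b + s); have := ha (b + s); have := hb (a + s).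
  by rewrite /lo /hi; have [ab|ab] := leP a b; lia.
exists (N + `|L| + 1) => y s hs.
have [s1 [y1 y2 hs1]] := PN (lo - `|L|) y.
have hs1' : agree s1 (lo - `|L|) (hi + `|L| + 1) by apply: agree_sub hs1; lia.
have e1 := recur _ hs1'.
have e2 : h (a + (s1 + s)) = h a.
  by apply: recur; apply: agree_trans hs1' _; apply: agree_sub hs; lia.
have gs (l : int) : y <= l -> l < a + s1 -> g (l + s) = g l.
  by move=> l1 l2; apply: gL; apply: agree_sub hs; lia.
have := primitive_shift (s := s) hS (u := y) (v := a + s1) ltac:(lia) gs.
have -> : a + s1 + s = a + (s1 + s) by lia.
by lia.
Qed.

(** A level-n block is longer than [n]. So from level [|L|] on, the window of [f] at a place of the
    inner blocks reaches no further than one block beyond them. *)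
Lemma agree_cut_local (T : Type) (f : int -> T) : local_on x f ->
  exists n0 : nat, forall n (s u v : int), (n0 <= n)%N -> u + 1 < v ->
  agree s u v -> exists s' : int,
  (forall w : int, u <= w -> w <= v -> cut n (w + s) = cut n w + s') /\
  forall y : int, cut n (u + 1) <= y -> y <= cut n (v - 1) -> f (y + s') = f y.
Proof.
move=> [L fL]; exists `|L|%N => n s u v nL uv h.
have [s' [sh h']] := agree_cut xc n h ltac:(lia); exists s'; split=> // y y1 y2.
have := cut_grow xc n u; have := cut_grow xc n (v - 1).
have -> : v - 1 + 1 = v by lia.
by move=> g1 g2; apply: fL; apply: agree_sub h'; lia.
Qed.

Lemma block_sum_local (g : int -> int) : local_on x g ->
  exists n0 : nat, forall n (i j : int), (n0 <= n)%N ->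
  x (i - 1) = x (j - 1) -> x i = x j -> x (i + 1) = x (j + 1) ->
  block_sum n g i = block_sum n g j.
Proof.
move=> /agree_cut_local[n0 P]; exists n0 => n i j nn0 e1 e2 e3.
have h : agree (j - i) (i - 1) (i + 2).
  move=> l l1 l2; have [->|[->|->]] : l = i - 1 \/ (l = i \/ l = i + 1) by lia.
  - by rewrite e1; congr x; lia.
  - by rewrite e2; congr x; lia.
  - by rewrite e3; congr x; lia.
have [s' [sh gs]] := P n (j - i) (i - 1) (i + 2) nn0 ltac:(lia) h.
rewrite /block_sum.
have -> : cut n (j + 1) = cut n (i + 1) + s'.
  by rewrite -sh; [congr (cut n _)| |]; lia.
have -> : cut n j = cut n i + s'.
  by rewrite -sh; [congr (cut n _)| |]; lia.
apply: primitive_ext; last by apply: (cut_le xc); lia.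
move=> l l1 l2; rewrite gs //.
  by have -> : i - 1 + 1 = i by lia.
have -> : i + 2 - 1 = i + 1 by lia.
exact: ltW.
Qed.

(** The window at a cut meets only the two adjacent blocks; this is where the pairs of letters in
    [delta] come from. *)
Lemma cut_value_local (T : Type) (f : int -> T) : local_on x f ->
  exists n0 : nat, forall n (i j : int), (n0 <= n)%N ->
  x (i - 1) = x (j - 1) -> x i = x j -> f (cut n i) = f (cut n j).
Proof.
move=> /agree_cut_local[n0 P]; exists n0 => n i j nn0 e1 e2.
have h : agree (j - i) (i - 1) (i + 1).
  move=> l l1 l2; have [->|->] : l = i - 1 \/ l = i by lia.
  - by rewrite e1; congr x; lia.
  - by rewrite e2; congr x; lia.
have [s' [sh gs]] := P n (j - i) (i - 1) (i + 1) nn0 ltac:(lia) h.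
have -> : cut n j = cut n i + s'.
  by rewrite -sh; [congr (cut n _)| |]; lia.
apply/esym/gs; apply: (cut_le xc); lia.
Qed.

(** Equality of the two blocks as words; the letters [x i] and [x j] may still differ. *)
Definition same_block n (i j : int) : Prop :=
  agree (cut n j - cut n i) (cut n i) (cut n (i + 1)) /\
  cut n (j + 1) - cut n j = cut n (i + 1) - cut n i.

Lemma agree_same_block n (i j s : int) : cut n j = cut n i + s ->
  cut n (j + 1) = cut n (i + 1) + s -> agree s (cut n i) (cut n (i + 1)) ->
  same_block n i j.
Proof.
move=> e1 e2 h; split; last by lia.
by have -> : cut n j - cut n i = s by lia.
Qed.

Lemma same_block_trans n i j k :
  same_block n i j -> same_block n j k -> same_block n i k.
Proof.
move=> [h1 e1] [h2 e2]; split; last by rewrite e2.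
have -> : cut n k - cut n i = (cut n j - cut n i) + (cut n k - cut n j) by lia.
by apply: agree_trans h1 _; apply: agree_sub h2; lia.
Qed.

Lemma same_letter_block n i j : x i = x j -> same_block n i j.
Proof.
move=> e; have h : agree (j - i) i (i + 1).
  move=> l l1 l2; have -> : l = i by lia.
  by rewrite e; congr x; lia.
have [s' [sh hs]] := agree_cut xc n h ltac:(lia).
have E1 : cut n j = cut n i + s'.
  by rewrite -sh; [congr (cut n _)| |]; lia.
have E2 : cut n (j + 1) = cut n (i + 1) + s'.
  by rewrite -sh; [congr (cut n _)| |]; lia.
split; last by lia.
by have -> : cut n j - cut n i = s' by lia.
Qed.

Lemma same_blockS n i j : same_block n i j -> same_block n.+1 i j.
Proof.
move=> [h e]; have le : cut n i <= cut n (i + 1) by apply: (cut_le xc); lia.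
have [sh h'] := agree_cut1 xc h le; split.
  rewrite !iterS; move: h'.
  by have -> : cut n i + (cut n j - cut n i) = cut n j by lia.
have := sh (cut n (i + 1)) le (lexx _).
have -> : cut n i + (cut n j - cut n i) = cut n j by lia.
have -> : cut n (i + 1) + (cut n j - cut n i) = cut n (j + 1) by lia.
by rewrite !iterS; lia.
Qed.

(** By [same_blockS] the set of pairs of letters with equal level-n blocks grows with [n]; inside
    the finite set [A * A] it becomes constant. *)
Lemma same_block_stable : exists N : nat, forall n (i j : int),
  same_block n i j -> same_block N i j.
Proof.
pose P (ab : A * A) N := forall n i j, x i = ab.1 -> x j = ab.2 ->
  same_block n i j -> same_block N i j.
have [|[a b]|N PN] := finite_uniform_bound (P := P).
- move=> ab N N' NN' PN n i j ia jb /(PN n i j ia jb).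
  rewrite -(subnKC NN'); elim: (N' - N)%N => [|k IH] /[!(addn0,addnS)] // /IH.
  exact: same_blockS.
- have [[n [i [j [ia jb h]]]]|no] := pselect (exists n i j,
    [/\ x i = a, x j = b & same_block n i j]); last first.
    by exists 0%N => n i j ia jb h; case: no; exists n, i, j.
  exists n => m i' j' /= ia' jb' _.
  apply: same_block_trans (same_block_trans h _).
    by apply: same_letter_block; rewrite ia.
  by apply: same_letter_block; rewrite jb.
by exists N => n i j; exact: (PN (x i, x j)).
Qed.

(** The translate of each next cut is a cut past the start of the other block, hence not before the
    end of that block. *)
Lemma next_cut n (i j s : int) : cut n j = cut n i + s ->
  is_cut c n (cut n (i + 1) + s) -> is_cut c n (cut n (j + 1) - s) ->
  cut n (j + 1) = cut n (i + 1) + s.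
Proof.
move=> e [k ek] [m em].
have i1 := cut_lt xc n (u := i) (v := i + 1) ltac:(lia).
have j1 := cut_lt xc n (u := j) (v := j + 1) ltac:(lia).
have jk : j < k by apply: (cut_lt_inv xc (n := n)); lia.
have im : i < m by apply: (cut_lt_inv xc (n := n)); lia.
have := cut_le xc n (u := j + 1) (v := k) ltac:(lia).
by have := cut_le xc n (u := i + 1) (v := m) ltac:(lia); lia.
Qed.

Lemma prev_cut n (i j s : int) : cut n j = cut n i + s ->
  is_cut c n (cut n (i - 1) + s) -> is_cut c n (cut n (j - 1) - s) ->
  cut n (j - 1) = cut n (i - 1) + s.
Proof.
move=> e [k ek] [m em].
have i1 := cut_lt xc n (u := i - 1) (v := i) ltac:(lia).
have j1 := cut_lt xc n (u := j - 1) (v := j) ltac:(lia).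
have jk : k < j by apply: (cut_lt_inv xc (n := n)); lia.
have im : m < i by apply: (cut_lt_inv xc (n := n)); lia.
have := cut_le xc n (u := k) (v := j - 1) ltac:(lia).
by have := cut_le xc n (u := m) (v := i - 1) ltac:(lia); lia.
Qed.

(** Recognizability shows the cuts near [y] in a window, hence the words of the three blocks around
    a cut, which determine [f i]. So all of [f i] can be placed at the one point [cut n i]. *)
Lemma tower_function n (f : int -> int) :
  (forall i j : int, same_block n (i - 1) (j - 1) -> same_block n i j ->
    same_block n (i + 1) (j + 1) -> f i = f j) ->
  exists g : int -> int, [/\ local_on x g, forall i : int, g (cut n i) = f i &
    forall y : int, ~ is_cut c n y -> g y = 0].
Proof.
move=> fP.
pose g (y : int) := if pselect (is_cut c n y) is left e then f (projT1 (cid e)) else 0.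
have gcut i : g (cut n i) = f i.
  rewrite /g; case: pselect => [e|[]]; last by exists i.
  by case: (cid e) => k /= /(cut_inj xc) ->.
have gnot y : ~ is_cut c n y -> g y = 0 by rewrite /g; case: pselect.
exists g; split=> //; have [L cL] := recognizability xc n.
(* The three blocks around a cut [y] lie between [y - M ^+ n] and [y + 2 * M ^+ n]; [|L|] more make
   their cuts recognizable. *)
exists (`|L| + 2 * M ^+ n) => y s h.
have M0 : 0 <= M ^+ n by apply: exprn_ge0; have := bound_ge2 xc; lia.
have cutE z : y - 2 * M ^+ n <= z -> z <= y + 2 * M ^+ n ->
    is_cut c n (z + s) = is_cut c n z.
  by move=> z1 z2; apply: cL; apply: agree_sub h; lia.
have [yc|yc] := pselect (is_cut c n y); last first.
  by rewrite !gnot // cutE //; lia.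
have ysc : is_cut c n (y + s) by rewrite cutE //; lia.
case: yc => i yi; case: ysc => j ysj.
have b1 := cut_bound xc n i; have b2 := cut_bound xc n (i - 1).
have b3 := cut_bound xc n j; have b4 := cut_bound xc n (j - 1).
have b5 := cut_bound xc n (i + 1); have b6 := cut_bound xc n (j + 1).
have i1 : i - 1 + 1 = i by lia.
have j1 : j - 1 + 1 = j by lia.
rewrite i1 in b2; rewrite j1 in b4.
have l1 := cut_le xc n (u := i) (v := i + 1) ltac:(lia).
have l2 := cut_le xc n (u := j) (v := j + 1) ltac:(lia).
have l3 := cut_le xc n (u := i - 1) (v := i) ltac:(lia).
have l4 := cut_le xc n (u := j - 1) (v := j) ltac:(lia).
have l5 := cut_le xc n (u := i + 1) (v := i + 1 + 1) ltac:(lia).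
have l6 := cut_le xc n (u := j + 1) (v := j + 1 + 1) ltac:(lia).
have toc (k : int) : y - 2 * M ^+ n <= cut n k -> cut n k <= y + 2 * M ^+ n ->
    is_cut c n (cut n k + s).
  by move=> k1 k2; rewrite cutE //; exists k.
have fromc (k : int) : y - 2 * M ^+ n <= cut n k - s ->
    cut n k - s <= y + 2 * M ^+ n -> is_cut c n (cut n k - s).
  by move=> k1 k2; rewrite -cutE //; exists k; lia.
have e0 : cut n j = cut n i + s by lia.
have e1 : cut n (j + 1) = cut n (i + 1) + s.
  by apply: next_cut => //; [apply: toc|apply: fromc]; lia.
have e2 : cut n (j - 1) = cut n (i - 1) + s.
  by apply: prev_cut => //; [apply: toc|apply: fromc]; lia.
have e3 : cut n (j + 1 + 1) = cut n (i + 1 + 1) + s.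
  by apply: next_cut => //; [apply: toc|apply: fromc]; lia.
rewrite ysj yi !gcut; apply/esym/fP; apply: (agree_same_block (s := s)).
- exact: e2.
- by rewrite i1 j1.
- by rewrite i1; apply: agree_sub h; lia.
- exact: e0.
- exact: e1.
- by apply: agree_sub h; lia.
- exact: e1.
- exact: e3.
- by apply: agree_sub h; lia.
Qed.

Lemma block_sum_cut_only n (f g : int -> int) :
  (forall i : int, g (cut n i) = f i) -> (forall y : int, ~ is_cut c n y -> g y = 0) ->
  forall i : int, block_sum n g i = f i.
Proof.
move=> gf g0 i; have ii := cut_lt xc n (u := i) (v := i + 1) ltac:(lia).
rewrite /block_sum.
have tail (v : int) : cut n i + 1 <= v -> v <= cut n (i + 1) ->
    primitive g v = primitive g (cut n i + 1).
  move: v; apply: int_le_ind => [//|v v1 IH v2].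
  rewrite primitiveS IH ?g0 ?addr0 //; last by lia.
  move=> [k vk].
  have := cut_lt_inv xc (n := n) (u := i) (v := k) ltac:(lia).
  by have := cut_lt_inv xc (n := n) (u := k) (v := i + 1) ltac:(lia); lia.
by rewrite tail ?primitiveS ?gf; lia.
Qed.

Lemma block_sum_ge0 n (g : int -> int) i :
  (forall y : int, 0 <= g y) -> 0 <= block_sum n g i.
Proof.
move=> g0; rewrite subr_ge0.
have := @step_lower (primitive g) 0 _ (cut n i) (cut n (i + 1)) _.
rewrite mulr0 addr0; apply; last by apply: (cut_le xc); lia.
by move=> l; rewrite addr0 primitiveS; have := g0 l; lia.
Qed.

(** By [same_block_stable], equal blocks of level [m + N] give equal blocks of level [N]. Three
    consecutive ones determine the triples centred in the middle level-N block, hence the sum of [P]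
    over it, though perhaps not [P i] itself. *)
Lemma tower_realization (P : int -> int) m :
  (forall i j : int, x (i - 1) = x (j - 1) -> x i = x j -> x (i + 1) = x (j + 1) ->
    P i = P j) ->
  exists N (g : int -> int), [/\ local_on x g,
    forall i : int, block_sum (m + N) g i = block_sum N P i &
    (forall i : int, 0 <= P i) -> forall y : int, 0 <= g y].
Proof.
move=> PP; have [N stable] := same_block_stable; exists N.
have PN (i j : int) : same_block (m + N) (i - 1) (j - 1) -> same_block (m + N) i j ->
    same_block (m + N) (i + 1) (j + 1) -> block_sum N P i = block_sum N P j.
  move=> /stable b1 /stable b2 /stable b3; rewrite /block_sum.
  case: b1 b2 b3 => h1 e1 [h2 e2] [h3 e3].
  have i1 : i - 1 + 1 = i by lia.
  have j1 : j - 1 + 1 = j by lia.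
  rewrite i1 in h1 e1; rewrite j1 in e1.
  pose s : int := cut N j - cut N i.
  have s1 : cut N (j - 1) - cut N (i - 1) = s by rewrite /s; lia.
  have s3 : cut N (j + 1) - cut N (i + 1) = s by rewrite /s; lia.
  rewrite s1 in h1; rewrite s3 in h3; rewrite -/s in h2.
  have l1 := cut_lt xc N (u := i - 1) (v := i) ltac:(lia).
  have l2 := cut_lt xc N (u := i) (v := i + 1) ltac:(lia).
  have l3 := cut_lt xc N (u := i + 1) (v := i + 1 + 1) ltac:(lia).
  have h (l : int) : cut N (i - 1) <= l -> l < cut N (i + 1 + 1) -> x (l + s) = x l.
    have [?|?] := ltP l (cut N i); first by move=> *; apply: h1; lia.
    have [?|?] := ltP l (cut N (i + 1)); first by move=> *; apply: h2; lia.
    by move=> *; apply: h3; lia.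
  have -> : cut N (j + 1) = cut N (i + 1) + s by rewrite /s; lia.
  have -> : cut N j = cut N i + s by rewrite /s; lia.
  apply: primitive_ext => [l u1 u2|]; last by lia.
  apply: PP.
  - by rewrite -(h (l - 1)); [congr x; lia|lia..].
  - by rewrite h //; lia.
  - by rewrite -(h (l + 1)); [congr x; lia|lia..].
have [g [gl gc g0]] := tower_function PN; exists g; split=> //.
  exact: block_sum_cut_only gc g0.
move=> P0 y; have [[i ->]|yc] := pselect (is_cut c (m + N) y); last by rewrite g0.
by rewrite gc; exact: block_sum_ge0.
Qed.

End Towers.

(** The isomorphism is given by its graph, since both directions involve choosing a high enough
    level. Compatibility with differences reduces uniqueness to the elements related to 0. *)
Lemma ord_isomorphic_of_relation (G H : ordGroup) (r : G -> H -> Prop) :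
  (forall a a' b b', r a b -> r a' b' -> r (a - a') (b - b')) ->
  (forall a, exists b, r a b) -> (forall b, exists a, r a b) ->
  (forall a, r a 0 -> a = 0) -> (forall b, r 0 b -> b = 0) ->
  (forall a, pos_cone a -> exists2 b, pos_cone b & r a b) ->
  (forall b, pos_cone b -> exists2 a, pos_cone a & r a b) ->
  ord_isomorphic G H.
Proof.
move=> rB /choice[f rf] /choice[g rg] r_inj r_fun rpos rneg.
have uf a b b' : r a b -> r a b' -> b = b'.
  move=> h h'; apply/eqP; rewrite -subr_eq0; apply/eqP/r_fun.
  by rewrite -(subrr a); exact: rB.
have ug a a' b : r a b -> r a' b -> a = a'.
  move=> h h'; apply/eqP; rewrite -subr_eq0; apply/eqP/r_inj.
  by rewrite -(subrr b); exact: rB.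
have fB : zmod_morphism f by move=> a a'; apply: uf (rf _) _; exact: rB.
pose F : {additive G -> H} := HB.pack f (GRing.isZmodMorphism.Build G H f fB).
exists F; split.
  exists g => [a|b]; first exact: ug (rg _) (rf _).
  exact: uf (rf _) (rg _).
move=> a; split=> [/rpos[b pb rab]|/rneg[a' pa' ra]].
  by have -> : F a = b by exact: uf (rf a) rab.
by have -> : a = a' by exact: ug (rf a) ra.
Qed.

(** * Words and sums over triples *)

Section Windows.
Variable A : Type.
Implicit Types (x : int -> A) (i : int) (m n : nat).

Definition subword x i n : seq A := [seq x (i + k%:Z) | k <- iota 0 n].

Lemma size_subword x i n : size (subword x i n) = n.
Proof. by rewrite size_map size_iota. Qed.

Lemma nth_subword a x i n k : (k < n)%N -> nth a (subword x i n) k = x (i + k%:Z).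
Proof. by move=> kn; rewrite (nth_map 0%N) ?size_iota // nth_iota. Qed.

Lemma subwordD x i m n :
  subword x i (m + n) = subword x i m ++ subword x (i + m%:Z) n.
Proof.
rewrite /subword iotaD map_cat add0n; congr (_ ++ _).
rewrite -[m in iota m n]addn0 iotaDl -map_comp; apply: eq_map => k /=.
by congr x; lia.
Qed.

Lemma subwordS x i n : subword x i n.+1 = x i :: subword x (i + 1) n.
Proof. by rewrite -add1n subwordD /= addr0. Qed.

Lemma eq_subword x y i j n : subword x i n = subword y j n <->
  forall k, (k < n)%N -> x (i + k%:Z) = y (j + k%:Z).
Proof.
split=> [e k kn|e]; last by apply/eq_in_map => k; rewrite mem_iota => /e.
by rewrite -(nth_subword (x i) x i kn) e nth_subword.
Qed.

Lemma subword_split x i m n k u v w : subword x i (m + n + k) = u ++ v ++ w ->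
  size u = m -> size v = n -> subword x (i + m%:Z) n = v.
Proof.
rewrite -addnA !subwordD => e su sv.
move/(congr1 (drop m)): (e).
rewrite -{1}su !drop_size_cat ?size_subword //.
move/(congr1 (take n)); rewrite -{1}sv !take_size_cat ?size_subword //.
Qed.

End Windows.

Lemma infix_subword (A : eqType) (x : int -> A) (i j : int) (m n : nat) :
  i <= j -> j + m%:Z <= i + n%:Z -> infix (subword x j m) (subword x i n).
Proof.
move=> ij jm; apply/infixP.
exists (subword x i `|(j - i)%R|%N), (subword x (j + m%:Z) `|(i + n%:Z - (j + m%:Z))%R|%N).
have -> : n = (`|(j - i)%R| + (m + `|(i + n%:Z - (j + m%:Z))%R|))%N by lia.
rewrite subwordD; congr (_ ++ _).
have -> : i + (`|(j - i)%R|%N)%:Z = j by lia.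
by rewrite subwordD; congr (_ ++ subword _ _ _); lia.
Qed.

Lemma infix_subwordP (A : eqType) (x : int -> A) (i : int) (n : nat) (w : seq A) :
  infix w (subword x i n) -> exists2 j : int, i <= j & subword x j (size w) = w.
Proof.
move=> /infixP[u [v e]]; exists (i + (size u)%:Z); first by lia.
apply: (@subword_split _ x i (size u) (size w) (size v) u w v) => //.
rewrite -e; congr subword.
by rewrite -(size_subword x i n) e !size_cat addnA.
Qed.

Section Words.
Variables (A : finType) (sigma : substitution A).
Local Notation ext := (subst_ext sigma).
Local Notation word n a := (subst_iter sigma n a).

Lemma iter_ext_cat n u v : iter n ext (u ++ v) = iter n ext u ++ iter n ext v.
Proof. by elim: n => //= n ->; exact: subst_ext_cat. Qed.

Lemma iter_ext_cons n a v : iter n ext (a :: v) = word n a ++ iter n ext v.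
Proof. by rewrite -cat1s iter_ext_cat. Qed.

Lemma word_add m n a : word (m + n) a = iter m ext (word n a).
Proof. exact: iterD. Qed.

Lemma size_ext w : (size w <= size (ext w))%N.
Proof.
elim: w => //= a w IH; rewrite /subst_ext /= size_cat.
by have := subst_word_size sigma a; rewrite -/(subst_ext sigma w); lia.
Qed.

Lemma size_iter_ext n w : (size w <= size (iter n ext w))%N.
Proof. by elim: n => //= n IH; exact: leq_trans IH (size_ext _). Qed.

Lemma word_gt0 n a : (0 < size (word n a))%N.
Proof. exact: size_iter_ext n [:: a]. Qed.

(** The default is the letter preceding [w]; mapping it along makes the formula hold for empty [w]
    too. *)
Lemma last_ext l w : last (last l (sigma l)) (ext w) = last (last l w) (sigma (last l w)).
Proof.
elim/last_ind: w => //= w a _; rewrite last_rcons -cats1 subst_ext_cat last_cat.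
rewrite /subst_ext /= cats0; have := subst_word_size sigma a.
by case: (sigma a).
Qed.

Lemma head_ext r w : head (head r (sigma r)) (ext w) = head (head r w) (sigma (head r w)).
Proof.
case: w => //= a w; rewrite /subst_ext /=; have := subst_word_size sigma a.
by case: (sigma a).
Qed.

Lemma last_wordS n a :
  last a (word n.+1 a) = last (last a (word n a)) (sigma (last a (word n a))).
Proof.
rewrite -last_ext /= -/(subst_iter sigma n a).
have := leq_trans (word_gt0 n a) (size_ext _).
by case: (ext _).
Qed.

Lemma head_wordS n a :
  head a (word n.+1 a) = head (head a (word n a)) (sigma (head a (word n a))).
Proof.
rewrite -head_ext /= -/(subst_iter sigma n a).
have := leq_trans (word_gt0 n a) (size_ext _).
by case: (ext _).
Qed.

Lemma in_language_iter_ext n w :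
  in_language sigma w -> in_language sigma (iter n ext w).
Proof. by move=> wL; elim: n => //= n; exact: in_language_subst. Qed.

Lemma infix_iter_ext n u v : infix u v -> infix (iter n ext u) (iter n ext v).
Proof.
move=> /infixP[p [q ->]]; rewrite !iter_ext_cat; apply/infixP.
by exists (iter n ext p), (iter n ext q).
Qed.

Fixpoint triple_sum (q : A * A * A -> int) (l : A) (w : seq A) (r : A) : int :=
  if w is b :: w' then q (l, b, head r w') + triple_sum q b w' r else 0.

Lemma triple_sum_cat q l u v r :
  triple_sum q l (u ++ v) r =
  triple_sum q l u (head r v) + triple_sum q (last l u) v r.
Proof.
elim: u l => [|b u IH] l /=; first by rewrite add0r.
by rewrite IH addrA; case: u {IH}.
Qed.

Lemma triple_sum_nth q d l w r :
  triple_sum q l w r = \sum_(i < size w)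
    q (nth d (l :: rcons w r) i, nth d (l :: rcons w r) i.+1,
       nth d (l :: rcons w r) i.+2).
Proof.
elim: w l => [|b w IH] l; first by rewrite big_ord0.
rewrite big_ord_recl /= IH; congr (_ + _).
by case: w {IH}.
Qed.

(** beta^Q on functions of all triples, so that word computations avoid the subtype [AQ]. *)
Definition pull (q : A * A * A -> int) (t : A * A * A) : int :=
  \sum_(u <- sigmaQ_word sigma t) q u.

Lemma pullE q a b d : pull q (a, b, d) =
  triple_sum q (last a (sigma a)) (sigma b) (head d (sigma d)).
Proof.
rewrite (triple_sum_nth _ b) /pull /sigmaQ_word big_map.
by rewrite -[size (sigma b) in LHS]subn0 -/(index_iota _ _) big_mkord.
Qed.

Lemma triple_sum_pull q l w r : triple_sum (pull q) l w r =
  triple_sum q (last l (sigma l)) (ext w) (head r (sigma r)).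
Proof.
elim: w l => //= b w IH l; rewrite IH pullE.
rewrite /subst_ext /= -/(subst_ext sigma w) triple_sum_cat head_ext.
by congr (_ + triple_sum _ _ _ _); have := subst_word_size sigma b; case: (sigma b).
Qed.

Lemma iter_pullE n q a b d : iter n pull q (a, b, d) =
  triple_sum q (last a (word n a)) (word n b) (head d (word n d)).
Proof.
elim: n q => [|n IH] q; first by rewrite /= addr0.
by rewrite iterSr IH triple_sum_pull -last_wordS -head_wordS.
Qed.

Lemma triple_sum_subword q (x : int -> A) (i : int) n :
  let P (l : int) := q (x (l - 1), x l, x (l + 1)) in
  triple_sum q (x (i - 1)) (subword x i n) (x (i + n%:Z)) =
  primitive P (i + n%:Z) - primitive P i.
Proof.
move=> P; elim: n i => [|n IH] i; first by rewrite addr0 subrr.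
rewrite subwordS /=.
have -> : i + n.+1%:Z = i + 1 + n%:Z by lia.
have := IH (i + 1); have -> : i + 1 - 1 = i by lia.
move=> ->; rewrite primitiveS.
have -> : head (x (i + 1 + n%:Z)) (subword x (i + 1) n) = x (i + 1).
  by case: n {IH} => [|n]; rewrite ?addr0 // subwordS.
by rewrite -/(P i); lia.
Qed.

Lemma betaQ_pull (p : ZAQ sigma) q :
  (forall t : AQ sigma, (p : {ffun AQ sigma -> int}) t = q (val t)) ->
  forall t : AQ sigma, (betaQ sigma p : {ffun AQ sigma -> int}) t = pull q (val t).
Proof.
move=> pq t; rewrite ffunE /pull -val_sigmaQ big_map.
by apply: eq_bigr => u _; exact: pq.
Qed.

Lemma iter_betaQ_pull n (p : ZAQ sigma) q :
  (forall t : AQ sigma, (p : {ffun AQ sigma -> int}) t = q (val t)) ->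
  forall t : AQ sigma,
    (iter n (betaQ sigma) p : {ffun AQ sigma -> int}) t = iter n pull q (val t).
Proof. by move=> pq; elim: n => //= n IH; exact: betaQ_pull. Qed.

End Words.

(** * A two-sided fixed point *)

Section Existence.
Variables (A : finType) (sigma : substitution A).
Hypothesis prim : subst_primitive sigma.
Hypothesis aper : subst_aperiodic sigma.
Local Notation ext := (subst_ext sigma).
Local Notation word n a := (subst_iter sigma n a).

Lemma letter_in_words : exists n0, forall n a b, (n0 <= n)%N -> b \in word n a.
Proof.
have [n0 P] := prim; exists n0 => n a b n0n.
rewrite -(subnKC n0n) word_add; have := word_gt0 sigma (n - n0) a.
case: (word (n - n0) a) => // e w _.
by rewrite iter_ext_cons mem_cat P.
Qed.

Lemma two_letters : exists a b : A, a != b.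
Proof.
apply: contrapT => no; apply: aper.
have same (a b : A) : a = b.
  by apply/eqP; apply: contrapT => /negP ab; apply: no; exists a, b.
have [->|/set0P[y _]] := eqVneq (subst_shift_set sigma) set0.
  exact: finite_set0.
apply: sub_finite_set (finite_set1 y) => z _ /=.
by apply/funext => i; exact: same.
Qed.

(** A sequence of period [t] is determined by [t] letters, so a common period would make the shift
    space finite. *)
Lemma shift_set_not_periodic (t : nat) : (0 < t)%N ->
  ~ forall y, subst_shift_set sigma y -> forall i : int, y (i + t%:Z) = y i.
Proof.
move=> t0 per; apply: aper.
pose f (w : {ffun 'I_t -> A}) : int -> A :=
  fun i => w (Ordinal (ltn_pmod `|(i %% t%:Z)%Z|%N t0)).
apply: (@sub_finite_set _ _ (f @` [set: {ffun 'I_t -> A}])); last first.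
  by apply: finite_image; exact: finite_finset.
move=> y Sy; exists [ffun k : 'I_t => y (k : nat)%:Z] => //.
apply/funext => i; rewrite /f ffunE /=.
have t_neq0 : t%:Z != 0 by lia.
have m0 := modz_ge0 i t_neq0.
have mt : (i %% t%:Z)%Z < t%:Z by apply: ltz_pmod; lia.
rewrite modn_small; last by lia.
rewrite gez0_abs // [in RHS](divz_eq i t%:Z).
move: (i %/ t%:Z)%Z (i %% t%:Z)%Z => q r.
have pern (n : nat) (l : int) : y (n%:Z * t%:Z + l) = y l.
  elim: n => [|n IH]; first by rewrite mul0r add0r.
  by rewrite -[RHS]IH -(per y Sy (n%:Z * t%:Z + l)); congr y; lia.
have [q0|q0] := leP 0 q.
  by rewrite -(pern `|q|%N r); congr y; lia.
by rewrite -(pern `|q|%N (q * t%:Z + r)); congr y; lia.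
Qed.

(** The two letters at a junction determine those at the junction of the images. This map on a
    finite set has a periodic point, and a large multiple of the period also makes every letter
    occur in every word. *)
Lemma fixed_pair : exists k (a b : A), [/\ (0 < k)%N,
  in_language sigma [:: a; b], last a (word k a) = a, head b (word k b) = b
  & forall d, (1 < size (word k d))%N /\ forall e, e \in word k d].
Proof.
have [n0 letters] := letter_in_words; have [d0 [d1 d01]] := two_letters.
have size2 n d : (n0 <= n)%N -> (1 < size (word n d))%N.
  move=> n0n; have := letters n d d0 n0n; have := letters n d d1 n0n.
  case: (word n d) => [//|e [|//]]; rewrite !inE => /eqP e1 /eqP e0.
  by rewrite e0 e1 eqxx in d01.
pose f (ab : A * A) := (last ab.1 (sigma ab.1), head ab.2 (sigma ab.2)).
have fn n ab : iter n f ab = (last ab.1 (word n ab.1), head ab.2 (word n ab.2)).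
  by elim: n => [|n IH]; [case: ab|rewrite iterS IH last_wordS head_wordS].
have fL n ab : in_language sigma [:: ab.1; ab.2] ->
    in_language sigma [:: (iter n f ab).1; (iter n f ab).2].
  elim: n => // n IH /IH {IH}/in_language_subst; rewrite iterS.
  move: (iter n f ab) => [a b] /=; apply: in_language_infix.
  rewrite /subst_ext /= cats0.
  have := subst_word_size sigma a; have := subst_word_size sigma b.
  case/lastP: (sigma a) => // sa a'; case: (sigma b) => // b' sb _ _.
  rewrite last_rcons /= -cats1 -catA; apply/infixP; exists sa, sb.
  by [].
have [ab0 ab0L] : exists ab : A * A, in_language sigma [:: ab.1; ab.2].
  have := size2 n0 d0 (leqnn _); case e: (word n0 d0) => [|a [|b w]] // _.
  by exists (a, b), d0, n0; rewrite e; apply/infixP; exists [::], w.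
have [u [v [uv euv]]] := nat_pigeonhole (fun n => iter n f ab0).
have [m [m0 mn0]] : exists m, (0 < m)%N /\ (n0 <= m * (v - u))%N.
  by exists n0.+1; split=> //; nia.
have per : iter (m * (v - u)) f (iter u f ab0) = iter u f ab0.
  elim: m {m0 mn0} => //= m IH.
  by rewrite mulSn iterD IH -iterD subnK // ltnW.
move: (fL u ab0 ab0L) per; case: (iter u f ab0) => a b abL.
rewrite fn => -[ea eb].
exists (m * (v - u))%N, a, b; split=> //.
  by rewrite muln_gt0 m0 subn_gt0.
by move=> d; split=> [|e]; [exact: size2|exact: letters].
Qed.

(* The two-sided limit of the words tau^j(a) . tau^j(b), where tau is the k-th
   power of sigma, tau(a) ends with a and tau(b) starts with b. *)
Section Limit.
Variables (k : nat) (a b : A).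
Hypothesis abL : in_language sigma [:: a; b].
Hypothesis last_a : last a (word k a) = a.
Hypothesis head_b : head b (word k b) = b.
Hypothesis big : forall d, (1 < size (word k d))%N /\ forall e, e \in word k d.

Let left j := word (j * k) a.
Let right j := word (j * k) b.
Let tau := iter k ext.

(** By [size_right] and [size_left] the words of index [n] have more than [n] letters, so no default
    is reached. *)
Definition limit_word (i : int) : A :=
  match i with
  | Posz n => nth b (right n) n
  | Negz n => nth a (rev (left n)) n
  end.
Local Notation x := limit_word.

Definition limit_cut : int -> int :=
  primitive (fun i => (size (word k (x i)))%:Z).
Local Notation c := limit_cut.

Let tau_left j : tau (left j) = left j.+1.
Proof. by rewrite /left mulSn word_add. Qed.

Let tau_right j : tau (right j) = right j.+1.
Proof. by rewrite /right mulSn word_add. Qed.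

Lemma right_prefix j : exists2 w, right j.+1 = right j ++ w & (0 < size w)%N.
Proof.
rewrite /right mulSn addnC word_add; have [] := big b; move: head_b.
case: (word k b) => [|e [|e' w]] //= -> _ _; rewrite iter_ext_cons.
by eexists; first by []; exact: leq_trans (size_iter_ext _ _ _).
Qed.

Lemma left_suffix j : exists2 w, left j.+1 = w ++ left j & (0 < size w)%N.
Proof.
rewrite /left mulSn addnC word_add; have [] := big a; move: last_a.
case/lastP: (word k a) => [|w e] //; rewrite last_rcons => ->.
rewrite size_rcons => w0 _; rewrite -cats1 iter_ext_cat.
by eexists; first by []; exact: leq_trans (size_iter_ext _ _ _).
Qed.

Lemma size_right j : (j < size (right j))%N.
Proof.
elim: j => // j IH; have [w -> w0] := right_prefix j.
by rewrite size_cat; lia.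
Qed.

Lemma size_left j : (j < size (left j))%N.
Proof.
elim: j => // j IH; have [w -> w0] := left_suffix j.
by rewrite size_cat; lia.
Qed.

Lemma right_nth m j n : (n < size (right j))%N -> nth b (right (j + m)) n = nth b (right j) n.
Proof.
move=> nj; elim: m => [|m IH]; first by rewrite addn0.
rewrite addnS; have [w -> _] := right_prefix (j + m).
rewrite nth_cat IH ifT //; apply: leq_trans nj _.
rewrite /right mulnDl addnC word_add; exact: size_iter_ext.
Qed.

Lemma left_nth m j n : (n < size (left j))%N ->
  nth a (rev (left (j + m))) n = nth a (rev (left j)) n.
Proof.
move=> nj; elim: m => [|m IH]; first by rewrite addn0.
rewrite addnS; have [w -> _] := left_suffix (j + m).
rewrite rev_cat nth_cat size_rev IH ifT //; apply: leq_trans nj _.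
rewrite /left mulnDl addnC word_add; exact: size_iter_ext.
Qed.

Lemma subword_right j : subword x 0 (size (right j)) = right j.
Proof.
apply: (@eq_from_nth _ b); rewrite size_subword // => n nj.
rewrite nth_subword // add0r /=; have [jn|nj'] := leqP j n.
  by rewrite -(subnKC jn) right_nth // subnKC.
by rewrite -[in RHS](subnKC (ltnW nj')) right_nth ?size_right.
Qed.

Lemma subword_left j : subword x (- (size (left j))%:Z) (size (left j)) = left j.
Proof.
apply: (@eq_from_nth _ a); rewrite size_subword // => n nj.
rewrite nth_subword //.
have -> : - (size (left j))%:Z + n%:Z = Negz (size (left j) - n.+1) by lia.
rewrite -[in RHS](revK (left j)) nth_rev size_rev //=.
set m := (size (left j) - n.+1)%N; have mj : (m < size (left j))%N by rewrite /m; lia.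
have [jm|mj'] := leqP j m.
  by have := left_nth (m - j) mj; rewrite subnKC.
by have := left_nth (j - m) (size_left m); rewrite subnKC // ltnW.
Qed.

Lemma subword_center j :
  subword x (- (size (left j))%:Z) (size (left j) + size (right j)) =
  left j ++ right j.
Proof. by rewrite subwordD subword_left addNr subword_right. Qed.

Lemma limit_cutS i : c (i + 1) = c i + (size (word k (x i)))%:Z.
Proof. exact: primitiveS. Qed.

Lemma limit_cut0 : c 0 = 0.
Proof. exact: big_ord0. Qed.

Lemma limit_cutD i n : c (i + n%:Z) = c i + (size (tau (subword x i n)))%:Z.
Proof.
elim: n i => [|n IH] i.
  rewrite addr0 /tau; have -> : iter k ext [::] = [::] by elim: (k) => //= ? ->.
  by rewrite addr0.
have -> : i + n.+1%:Z = i + 1 + n%:Z by lia.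
rewrite IH limit_cutS subwordS /tau iter_ext_cons size_cat; lia.
Qed.

Lemma limit_cut_left j : c (- (size (left j))%:Z) = - (size (left j.+1))%:Z.
Proof.
have := limit_cutD (- (size (left j))%:Z) (size (left j)).
by rewrite addNr limit_cut0 subword_left tau_left; lia.
Qed.

(** The central word of index [|i|] covers the place [i], and tau maps it to the next central word;
    the images of the letters before [x i] account for the position [c i]. *)
Lemma subword_block i : subword x (c i) (size (word k (x i))) = word k (x i).
Proof.
pose j := `|i|%N; have Lj := size_left j; have Rj := size_right j.
set s := size (left j) in Lj; set s' := size (right j) in Rj.
pose m := `|(i + s%:Z)%R|%N; pose n := (s + s' - m.+1)%N.
have im : i = - s%:Z + m%:Z by lia.
have e : subword x (- s%:Z) (s + s') =
    subword x (- s%:Z) m ++ x i :: subword x (i + 1) n.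
  have -> : (s + s' = m + n.+1)%N by lia.
  by rewrite subwordD subwordS -im.
have tauD u v : tau (u ++ v) = tau u ++ tau v by exact: iter_ext_cat.
have tauC d v : tau (d :: v) = word k d ++ tau v by exact: iter_ext_cons.
have := congr1 tau e; rewrite subword_center !tauD tauC tau_left tau_right.
rewrite -subword_center.
set u := tau (subword x (- s%:Z) m); set v := tau (subword x (i + 1) n) => e'.
have -> : c i = - (size (left j.+1))%:Z + (size u)%:Z.
  by rewrite im limit_cutD limit_cut_left.
apply: (@subword_split _ x _ (size u) _ (size v) u _ v) => //.
by rewrite -e'; congr subword; rewrite -(size_subword x (- (size (left j.+1))%:Z)
   (size (left j.+1) + size (right j.+1))) e' !size_cat addnA.
Qed.

Lemma limit_word_language i n : in_language sigma (subword x i n).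
Proof.
pose j := (`|i| + n)%N; have Lj := size_left j; have Rj := size_right j.
have LR : in_language sigma (left j ++ right j).
  by have := in_language_iter_ext (j * k) abL; rewrite -cat1s iter_ext_cat.
apply: in_language_infix LR; rewrite -subword_center; apply: infix_subword; lia.
Qed.

(** The non-negative place serves [fp_pair], which asks for a copy of the central pair away from the
    origin. *)
Lemma language_in_limit_word w : in_language sigma w ->
  exists2 i : int, 0 <= i & subword x i (size w) = w.
Proof.
move=> [d [n wd]]; have [n0 letters] := letter_in_words.
have k0 : (0 < k)%N.
  by case: (posnP k) big => // -> /(_ a)[].
pose j := (n + n0)%N.
have nj : (n + n0 <= j * k)%N by rewrite leq_pmulr.
apply: (infix_subwordP (n := size (right j))).
rewrite subword_right /right; apply: infix_trans wd _.
rewrite -(subnKC (leq_trans (leq_addr _ _) nj)) word_add.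
have : d \in word (j * k - n) b by apply: letters; lia.
case/splitPr => u v; apply: infix_iter_ext.
by apply/infixP; exists u, v.
Qed.

Lemma limit_fixed_point : exists M : int, fixed_point x c M.
Proof.
have sizeE i : c (i + 1) - c i = (size (word k (x i)))%:Z by rewrite limit_cutS; lia.
have block i n : (n < size (word k (x i)))%N -> x (c i + n%:Z) = nth a (word k (x i)) n.
  by move=> ni; rewrite -(nth_subword a x (c i) ni) subword_block.
have [B sizeB] : exists B : nat, forall d, (size (word k d) <= B)%N.
  by exists (\max_d size (word k d)) => d; exact: leq_bigmax.
exists B%:Z; split.
- exact: limit_cut0.
- by move=> i; rewrite limit_cutS; have [] := big (x i); lia.
- by move=> i; rewrite limit_cutS; have := sizeB (x i); lia.
- by move=> i j e; rewrite !sizeE e.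
- move=> i j r e r0; rewrite sizeE => ri.
  have -> : r = (`|r|%N)%:Z by lia.
  by rewrite !block -?e //; lia.
- move=> i j; have [_ /(_ (x j)) h] := big (x i).
  have /(nthP a)[n nlt en] := h.
  by exists (c i + n%:Z); split; [lia|rewrite limit_cutS ltrD2l ltz_nat|rewrite block].
- have [i i0 /=] := language_in_limit_word abL.
  rewrite !subwordS => -[ea eb]; exists (i + 1); split; first by lia.
    by have -> : i + 1 - 1 = i by lia.
  exact: eb.
(* A period of [x] would be a period of every point, since all words of length [t + 1] of the points
   occur in [x]. *)
move=> t t0; apply: contrapT => no; apply: (@shift_set_not_periodic `|t|%N); first by lia.
move=> y Sy i; have [l _] := language_in_limit_word (Sy i `|t|.+1).
rewrite size_map size_iota => /eq_subword e.
have := e `|t|%N (ltnSn _); have := e 0%N isT; rewrite !addr0 => <- <-.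
apply: contrapT => xl; apply: no; exists l.
by have <- : `|t|%N%:Z = t by lia.
Qed.

End Limit.

End Existence.

(** * Continuous functions have a window *)

Section Cylinders.
Local Open Scope classical_set_scope.
Variable A : finType.
Local Notation seqs := {ptws int -> discrete_topology A}.

Definition agree_upto (R : nat) (y z : seqs) : Prop :=
  forall i : int, `|i| <= R%:Z -> z i = y i.

Lemma cylinder_nbhs (R : nat) (y : seqs) : \forall z \near y, agree_upto R y z.
Proof.
have FF : Filter (nbhs y) by exact: nbhs_filter.
have : \forall z \near y, forall k : 'I_(R + R).+1, z (k%:Z - R%:Z) = y (k%:Z - R%:Z).
  apply: (@filter_forall _ _ (fun (k : 'I_(R + R).+1) (z : seqs) =>
    z (k%:Z - R%:Z) = y (k%:Z - R%:Z)) (nbhs y)) => k.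
  exact: (@proj_continuous int (fun=> discrete_topology A) (k%:Z - R%:Z) y
    _ (discrete_set1 _)).
apply: filterS => z h i iR; have lt : (`|(i + R%:Z)%R| < (R + R).+1)%N by lia.
have := h (Ordinal lt) => /=.
by have -> : (`|(i + R%:Z)%R|%N)%:Z - R%:Z = i by lia.
Qed.

Lemma nbhs_cylinder (y : seqs) (U : set seqs) : nbhs y U ->
  exists R, forall z, agree_upto R y z -> U z.
Proof.
pose F := filter_from [set: nat] (fun R => [set z | agree_upto R y z]).
have FF : Filter F.
  apply: filter_from_filter; first by exists 0%N.
  move=> R S _ _; exists (maxn R S) => // z h.
  by split=> i iR; apply: h; lia.
have : F --> y.
  apply/cvg_sup => i V.
  rewrite nbhsE => -[B [[W oW <-] By] BV].
  apply: filterS BV _; exists `|i|%N => // z h /=.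
  by rewrite /= (h i) //; lia.
by move=> /[apply] -[R _ RU]; exists R => z /RU.
Qed.

End Cylinders.

Section Continuity.
Local Open Scope classical_set_scope.
Variables (A : finType) (sigma : substitution A).
Local Notation X := (subst_space sigma).

Lemma compact_subst_shift_set : compact (subst_shift_set sigma).
Proof.
have cA : compact [set: discrete_topology A].
  by apply: finite_compact; exact: (@finite_finset A).
have cT := @tychonoff int (fun=> discrete_topology A) _ (fun=> cA).
apply: subclosed_compact cT _ => // y.
move=> yS i n.
have [z [Sz yz]] := yS _ (cylinder_nbhs (`|i| + n)%N y).
have := Sz i n; congr (in_language sigma); apply/eq_in_map => k.
by rewrite mem_iota => kn; apply: yz; lia.
Qed.

(** Compactness makes the radius of local constancy uniform. *)
Lemma continuousZ_window (f : continuousZ X) : exists R : nat, forall y z : X,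
  agree_upto R (set_val y) (set_val z) -> f z = f y.
Proof.
have /compact_near_coveringP cov := compact_subst_shift_set.
pose P (R : nat) (y : {ptws int -> discrete_topology A}) :=
  forall u z : X, set_val u = y -> agree_upto R y (set_val z) -> f z = f u.
have [|R _ PR] := cov nat \oo P _; last first.
  by exists R => y z; apply: (PR R _ (set_val y)) => //=; exact: set_valP.
move=> y Sy; pose u : X := SigSub (mem_set Sy).
have vu : set_val u = y by [].
have : nbhs u [set v | f v = f u] by exact: (continuousZP _ (valP f)).
rewrite nbhsE => -[_ [[V oV <-] Vu] Vf].
have [R VR] := nbhs_cylinder (open_nbhs_nbhs (conj oV Vu)).
exists ([set z | agree_upto R y z], [set n | (R <= n)%N]).
  by split; [exact: cylinder_nbhs|exists R].
move=> [z n] /= [yz Rn] v w vz vw.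
have -> : f v = f u by apply: Vf => /=; apply: VR; rewrite vz vu.
apply: Vf => /=; apply: VR => i iR.
by rewrite vw; [exact: yz|lia].
Qed.

Lemma window_continuousZ (f : X -> int) (R : nat) :
  (forall y z : X, agree_upto R (set_val y) (set_val z) -> f z = f y) ->
  f \in @continuousZ_pred X.
Proof.
move=> fR; apply/continuousZP => y.
have FF : Filter (nbhs y) by exact: nbhs_filter.
have cyl : \forall z \near y, agree_upto R (set_val y) (set_val z).
  exact: (initial_continuous (cylinder_nbhs R (set_val y))).
by apply: (@filterS _ (nbhs y) FF _ _ _ cyl) => z; exact: fR.
Qed.

End Continuity.

(** * The comparison of the two groups *)

Section Groups.
Variables (V : zmodType) (G : ordGroup) (h : {additive V -> G}).

Lemma coker_surj (y : coker h) : exists u, y = coker_pi h u.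
Proof. by exists (repr y); exact: esym (reprK y). Qed.

Lemma coker_pi0 : coker_pi h 0 = 0 :> coker h.
Proof. exact: raddf0. Qed.

Lemma coker_piB u v : coker_pi h (u - v) = coker_pi h u - coker_pi h v :> coker h.
Proof. exact: raddfB. Qed.

Lemma coker_pi_eq0 u : coker_pi h u = 0 :> coker h <-> exists v, u = h v.
Proof. by rewrite -coker_pi0 coker_pi_eq subr0. Qed.

Lemma iter_coker_map (f : ordHom G G) (hf : forall v, exists v', f (h v) = h v') n u :
  iter n (coker_map hf) (coker_pi h u) = coker_pi h (iter n f u).
Proof. by elim: n => //= n ->; exact: coker_map_pi. Qed.

End Groups.

Section Limits.
Variables (G : ordGroup) (f : ordHom G G).

Lemma lim_inB n (u v : G) : lim_in f n (u - v) = lim_in f n u - lim_in f n v :> ind_lim f.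
Proof.
rewrite -[RHS]/(lim_add (lim_in f n u) (lim_opp (lim_in f n v))).
by rewrite lim_opp_in lim_add_in -iter_ordHomD lim_in_iter.
Qed.

Lemma lim_in0 n : lim_in f n 0 = 0 :> ind_lim f.
Proof. by apply/lim_in_eq; exists 0%N; rewrite !iter_ordHom0. Qed.

Lemma lim_in_eq0 n u : lim_in f n u = 0 :> ind_lim f -> exists m, iter m f u = 0.
Proof.
move=> /lim_in_eq[m e]; exists (m + 0)%N.
by rewrite e iter_ordHom0.
Qed.

End Limits.

Section BlockSums.
Variables (A : finType) (x : int -> A) (c : int -> int) (M : int).
Hypothesis xc : fixed_point x c M.

Lemma block_sumD m n g i :
  block_sum c (m + n) g i = block_sum c n (block_sum c m g) i.
Proof.
have st (l : int) : primitive g (iter m c (l + 1)) =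
    primitive g (iter m c l) + block_sum c m g l by rewrite /block_sum; lia.
rewrite [RHS]/block_sum (primitive_unique (h := fun l => primitive g (iter m c l)) st).
by rewrite -!iterD.
Qed.

Lemma block_sumB m g h i :
  block_sum c m (fun l => g l - h l) i = block_sum c m g i - block_sum c m h i.
Proof.
rewrite /block_sum.
rewrite (primitive_unique (h := fun l => primitive g l - primitive h l)); first by lia.
by move=> l; rewrite !primitiveS; lia.
Qed.

Lemma local_bounded (g : int -> int) : local_on x g ->
  exists B : int, forall i : int, `|g i| <= B.
Proof.
move=> [L gL].
pose P (w : {ffun 'I_(`|L|.+1 + `|L|.+1) -> A}) (N : nat) :=
  forall i : int, window x `|L|.+1 i = w -> `|g i| <= N%:Z.
have [|w|N PN] := finite_uniform_bound (P := P).
- by move=> w N N' NN' PN i /PN; lia.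
- have [[i wi]|no] := pselect (exists i, window x `|L|.+1 i = w); last first.
    by exists 0%N => i wi; case: no; exists i.
  exists `|g i|%N => j wj; have := window_agree (etrans wi (esym wj)).
  move=> ag; have := gL i (j - i); have -> : i + (j - i) = j by lia.
  by move=> ->; [lia|apply: agree_sub ag; lia].
by exists N%:Z => i; exact: (PN _ i erefl).
Qed.

Lemma bounded_on_blocks m (h : int -> int) (B B' : int) :
  (forall i : int, `|h (iter m c i)| <= B) ->
  (forall i : int, `|h (i + 1) - h i| <= B') ->
  exists B'' : int, forall i : int, `|h i| <= B''.
Proof.
move=> hB hB'; exists (B + M ^+ m * B') => y.
have [i /andP[iy yi]] := cut_cover xc m y.
have b := cut_bound xc m i.
have up := @step_upper h B' (fun l => ltac:(have := hB' l; lia)) _ _ iy.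
have lo := @step_lower h (- B') (fun l => ltac:(have := hB' l; lia)) _ _ iy.
have B'0 : 0 <= B' by have := hB' 0; lia.
have := hB i.
have : (y - iter m c i) * B' <= M ^+ m * B' by rewrite ler_wpM2r //; lia.
lia.
Qed.

End BlockSums.

Section Comparison.
Variables (A : finType) (sigma : substitution A).
Variables (x : int -> A) (c : int -> int) (M : int) (k : nat).
Hypothesis k_gt0 : (0 < k)%N.
Hypothesis xc : fixed_point x c M.
Hypothesis cS : forall i : int, c (i + 1) = c i + (size (subst_iter sigma k (x i)))%:Z.
Hypothesis x_block : forall i : int,
  subword x (c i) (size (subst_iter sigma k (x i))) = subst_iter sigma k (x i).
Hypothesis x_language : forall (i : int) n, in_language sigma (subword x i n).
Hypothesis language_x : forall w, in_language sigma w ->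
  exists2 i : int, 0 <= i & subword x i (size w) = w.

Local Notation X := (subst_space sigma).
Local Notation word a := (subst_iter sigma k a).
Local Notation ZAQ := (ZAQ sigma).
Local Notation AQ := (AQ sigma).

Lemma point_subproof (i : int) : (fun l => x (l + i)) \in subst_shift_set sigma.
Proof.
apply/mem_set => j n; have := x_language (j + i) n.
by congr in_language; apply: eq_map => l; congr x; lia.
Qed.

Definition point (i : int) : X := SigSub (point_subproof i).

Lemma pointE i l : set_val (point i) l = x (l + i).
Proof. by []. Qed.

Lemma shift_point i : subst_shift sigma (point i) = point (i + 1).
Proof.
apply: val_inj; apply/funext => l /=; rewrite /seq_shift /=.
by congr x; lia.
Qed.

Lemma agree_point R (i j : int) :
  agree_upto R (set_val (point i)) (set_val (point j)) <->
  shift_agree x (j - i) (i - R%:Z) (i + R%:Z + 1).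
Proof.
split=> [h l l1 l2|h l lR].
  have := h (l - i) ltac:(lia); rewrite !pointE.
  have -> : l - i + j = l + (j - i) by lia.
  by have -> : l - i + i = l by lia.
rewrite !pointE -(h (l + i)); [congr x; lia|lia..].
Qed.

Lemma point_dense R (y : X) : exists i, agree_upto R (set_val y) (set_val (point i)).
Proof.
have [i _] := language_x (set_valP y (- R%:Z) (R + R).+1).
rewrite size_map size_iota => /eq_subword e.
exists (i + R%:Z) => l lR /=.
have lt : (`|(l + R%:Z)%R| < (R + R).+1)%N by lia.
apply: etrans (etrans _ (e _ lt)) _; first by congr x; lia.
by congr (set_val y _); lia.
Qed.

Definition orbit_values (f : continuousZ X) (i : int) : int := f (point i).

Lemma orbit_values_local f : local_on x (orbit_values f).
Proof.
have [R fR] := continuousZ_window f; exists R%:Z => y s h.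
by apply: fR; apply/agree_point; have -> : y + s - y = s by lia.
Qed.

Lemma orbit_values_inj f g : orbit_values f = orbit_values g -> f = g.
Proof.
move=> e; apply: val_inj; apply/funext => y.
have [R fR] := continuousZ_window f; have [S gS] := continuousZ_window g.
have [i yi] := point_dense (maxn R S) y.
rewrite /= -(fR y (point i)); last by move=> l lR; apply: yi; lia.
rewrite -(gS y (point i)); last by move=> l lR; apply: yi; lia.
exact: (congr1 (fun h => h i) e).
Qed.

(** Each point of X_sigma looks near 0 like [x] near some place; locality makes the value of [g]
    there independent of the place chosen. *)
Lemma local_extension (g : int -> int) : local_on x g ->
  exists2 f : continuousZ X, orbit_values f = g &
    (forall i, 0 <= g i) -> pos_cone (f : continuousZ_ordGroup X).
Proof.
move=> [L gL]; pose R := `|L|%N.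
have gE (i j : int) (y : X) : agree_upto R (set_val y) (set_val (point i)) ->
    agree_upto R (set_val y) (set_val (point j)) -> g i = g j.
  move=> yi yj.
  have /agree_point h : agree_upto R (set_val (point i)) (set_val (point j)).
    by move=> l lR; rewrite yj ?yi.
  have := gL i (j - i); have -> : i + (j - i) = j by lia.
  by move=> ->//; apply: agree_sub h; rewrite /R; lia.
have [F FP] := choice (point_dense R).
have fR (y z : X) : agree_upto R (set_val y) (set_val z) -> g (F z) = g (F y).
  move=> yz; apply: (gE _ _ y) => [l lR|]; last exact: FP.
  by rewrite (FP z) // yz.
exists (ContinuousZ (window_continuousZ fR)) => [|g0 y]; last exact: g0.
by apply/funext => i; apply: (gE _ _ (point i)).
Qed.

Lemma triple_subproof (i : int) :
  `[< in_language sigma [:: (x (i - 1), x i, x (i + 1)).1.1;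
        (x (i - 1), x i, x (i + 1)).1.2; (x (i - 1), x i, x (i + 1)).2] >].
Proof.
apply/asboolP; have := x_language (i - 1) 3; rewrite !subwordS /=.
have -> : i - 1 + 1 = i by lia.
by [].
Qed.

Definition triple (i : int) : AQ := exist _ (x (i - 1), x i, x (i + 1)) (triple_subproof i).

Lemma triple_surj t : exists i, triple i = t.
Proof.
case: (t) (valP t) => [[[a b] d] abd] /= /asboolP/language_x[i _] /=.
rewrite !subwordS => -[ea eb ed].
exists (i + 1); apply: val_inj => /=; have -> : i + 1 - 1 = i by lia.
by rewrite ea eb ed.
Qed.

Lemma triple_eq i j : triple i = triple j ->
  [/\ x (i - 1) = x (j - 1), x i = x j & x (i + 1) = x (j + 1)].
Proof. by move/(congr1 val) => -[]. Qed.

Definition triple_values (p : ZAQ) (i : int) : int :=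
  (p : {ffun AQ -> int}) (triple i).

Lemma triple_values_inj p q : triple_values p = triple_values q -> p = q.
Proof.
move=> e; apply/ffunP => t; have [i <-] := triple_surj t.
exact: (congr1 (fun h => h i) e).
Qed.

Lemma x_nth i n a : (n < size (word (x i)))%N ->
  nth a (word (x i)) n = x (c i + n%:Z).
Proof. by move=> ni; rewrite -(nth_subword a x (c i) ni) x_block. Qed.

(** The letters flanking sigma^k([x i]) in [x] are the last of sigma^k([x (i - 1)]) and the first of
    sigma^k([x (i + 1)]), exactly those that iterating sigma^Q supplies. *)
Lemma betaQ_blocks1 p :
  triple_values (iter k (betaQ sigma) p) = block_sum c 1 (triple_values p).
Proof.
apply/funext => i.
pose q t : int := if insub t is Some u then (p : {ffun AQ -> int}) u else 0.
have qP (t : AQ) : (p : {ffun AQ -> int}) t = q (val t) by rewrite /q valK.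
rewrite /triple_values (iter_betaQ_pull k qP) iter_pullE.
have e1 : last (x (i - 1)) (word (x (i - 1))) = x (c i - 1).
  have := cS (i - 1); have -> : i - 1 + 1 = i by lia.
  have w0 := word_gt0 sigma k (x (i - 1)).
  by move=> ci; rewrite -nth_last x_nth; [congr x|]; lia.
have e2 : head (x (i + 1)) (word (x (i + 1))) = x (c (i + 1)).
  by rewrite -nth0 x_nth ?addr0 //; exact: word_gt0.
rewrite e1 e2 -{1}x_block cS triple_sum_subword /block_sum /= cS.
rewrite !(primitive_unique (h := primitive (triple_values p))) //.
all: by move=> l; rewrite primitiveS /triple_values qP.
Qed.

Lemma betaQ_blocks n p :
  triple_values (iter (k * n) (betaQ sigma) p) = block_sum c n (triple_values p).
Proof.
elim: n p => [|n IH] p.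
  by apply/funext => i; rewrite muln0 /block_sum /= primitiveS; lia.
rewrite mulnS addnC iterD IH betaQ_blocks1.
by apply/funext => i; rewrite -block_sumD.
Qed.

Local Notation piQ := (coker_pi (@delta A sigma)).
Local Notation piK := (coker_pi (coboundary (subst_shift sigma))).
Local Notation beta := (quotient_betaQ sigma).

Definition same_block_sums n (p : ZAQ) (f : continuousZ X) : Prop :=
  block_sum c n (orbit_values f) = triple_values p.

Lemma same_block_sums_lift m n p f : same_block_sums m p f ->
  same_block_sums (m + n) (iter (k * n) (betaQ sigma) p) f.
Proof.
move=> e; rewrite /same_block_sums betaQ_blocks -e.
by apply/funext => i; exact: block_sumD.
Qed.

Lemma same_block_sumsB n p q f g : same_block_sums n p f ->
  same_block_sums n q g -> same_block_sums n (p - q) (f - g).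
Proof.
move=> e1 e2; apply/funext => i; have := congr1 (fun h => h i) e1.
have := congr1 (fun h => h i) e2 => /= e2' e1'.
rewrite /triple_values !ffunE -/(triple_values _ _) -e1' -/(triple_values _ _).
by rewrite -e2' -block_sumB.
Qed.

Definition lim_rel (a : limQ sigma) (b : dimension_group sigma) : Prop :=
  exists n p f, [/\ a = lim_in beta (k * n) (piQ p), b = piK f &
    same_block_sums n p f].

Lemma lim_in_lift m n p :
  lim_in beta (k * (m + n)) (piQ (iter (k * n) (betaQ sigma) p)) =
  lim_in beta (k * m) (piQ p).
Proof.
rewrite mulnDr addnC -[RHS](lim_in_iter _ (k * n)).
by congr (lim_in _ _ _); apply: esym; exact: iter_coker_map.
Qed.

Lemma limQ_surj (a : limQ sigma) : exists n p, a = lim_in beta (k * n) (piQ p).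
Proof.
have [n [y ->]] := lim_inP a; have [p ->] := coker_surj y.
exists n, (iter (k * n - n) (betaQ sigma) p).
rewrite -[LHS](lim_in_iter _ (k * n - n)) subnK ?leq_pmull //.
by congr (lim_in _ _ _); exact: iter_coker_map.
Qed.

Lemma lim_relB a a' b b' : lim_rel a b -> lim_rel a' b' -> lim_rel (a - a') (b - b').
Proof.
move=> [m [p [f [-> -> e]]]] [n [q [g [-> -> e']]]].
exists (m + n)%N, (iter (k * n) (betaQ sigma) p - iter (k * m) (betaQ sigma) q), (f - g).
split; [|exact: esym (coker_piB _ _ _)|].
  by rewrite coker_piB lim_inB lim_in_lift addnC lim_in_lift.
apply: same_block_sumsB; first exact: same_block_sums_lift.
by rewrite addnC; exact: same_block_sums_lift.
Qed.

Lemma tower_function_exists m p : exists N f,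
  same_block_sums (m + N) (iter (k * N) (betaQ sigma) p) f /\
  (pos_cone p -> pos_cone (f : continuousZ_ordGroup X)).
Proof.
have [i j e1 e2 e3|N [g [gl gN g0]]] :=
  @tower_realization _ _ _ _ xc (triple_values p) m.
  congr ((p : {ffun AQ -> int}) _); apply: val_inj => /=.
  by rewrite e1 e2 e3.
have [f fg f0] := local_extension gl; exists N, f; split.
  by rewrite /same_block_sums betaQ_blocks fg; apply/funext.
by move=> p0; apply: f0; apply: g0 => i; exact: p0.
Qed.

Lemma block_sums_exist (f : continuousZ X) : exists n p,
  same_block_sums n p f /\ (pos_cone (f : continuousZ_ordGroup X) -> pos_cone p).
Proof.
have [n nP] := block_sum_local xc (orbit_values_local f).
have [F FP] := choice triple_surj.
exists n, [ffun t => block_sum c n (orbit_values f) (F t)]; split.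
  apply/funext => i; rewrite /triple_values ffunE.
  have [e1 e2 e3] := triple_eq (FP (triple i)).
  by apply: (nP n); rewrite ?leqnn.
by move=> f0 t; rewrite ffunE; apply: (block_sum_ge0 xc) => i; exact: f0.
Qed.

Lemma coboundary_orbit_values h i :
  orbit_values (coboundary (subst_shift sigma) h) i =
  orbit_values h i - orbit_values h (i + 1).
Proof. by rewrite /orbit_values -shift_point. Qed.

Lemma delta_triple_values phi i :
  triple_values (delta sigma phi) i = phi (x i, x (i + 1)) - phi (x (i - 1), x i).
Proof. by rewrite /triple_values ffunE. Qed.

(** The block sums of a coboundary telescope to the values of [h] at two cuts, and at high levels
    these depend on the adjacent pairs: up to sign they are [phi]. *)
Lemma lim_rel_inj a : lim_rel a 0 -> a = 0.
Proof.
move=> [m [p [f [-> /esym/coker_pi_eq0[h fh] e]]]].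
have [n nP] := cut_value_local xc (orbit_values_local h).
have := same_block_sums_lift n e; rewrite -(lim_in_lift m n).
move: (iter (k * n) _ p) => q eq.
have [phi phiP] : exists phi : {ffun A * A -> int}, forall i : int,
    phi (x (i - 1), x i) = - orbit_values h (iter (m + n) c i).
  pose P (ab : A * A) (v : int) := forall i : int, (x (i - 1), x i) = ab ->
    v = - orbit_values h (iter (m + n) c i).
  have [|phi phiP] := @choice _ _ P.
    move=> ab; have [[i abi]|no] := pselect (exists i : int, (x (i - 1), x i) = ab).
      exists (- orbit_values h (iter (m + n) c i)) => j.
      rewrite -abi => -[e1 e2]; congr (- _).
      by apply: nP => //; exact: leq_addl.
    by exists 0 => i abi; case: no; exists i.
  by exists [ffun ab => phi ab] => i; rewrite ffunE; exact: phiP.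
have -> : q = delta sigma phi.
  apply: triple_values_inj; apply/funext => i; rewrite delta_triple_values -eq fh.
  have := phiP (i + 1); have -> : i + 1 - 1 = i by lia.
  move=> ->; rewrite phiP /block_sum.
  rewrite (primitive_unique (h := fun l => - orbit_values h l)) //.
  by move=> l; rewrite coboundary_orbit_values; lia.
rewrite (_ : piQ _ = 0); first exact: lim_in0.
by apply/coker_pi_eq0; exists phi.
Qed.

(** At the cuts the primitive of [f] equals [phi] up to a constant, so it is bounded there, then
    everywhere as blocks of a fixed level have bounded length. Bounded, it is local and extends to
    X_sigma. *)
Lemma lim_rel_fun b : lim_rel 0 b -> b = 0.
Proof.
move=> [m [p [f [/esym/lim_in_eq0[n e0] -> e]]]].
have [phi phiE] : exists phi, iter (k * n) (betaQ sigma) p = delta sigma phi.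
  apply/coker_pi_eq0; rewrite -(iter_coker_map (@betaQ_delta A sigma)).
  by rewrite -(subnK (leq_pmull n k_gt0)) iterD e0 iter_ordHom0.
have {e e0} := same_block_sums_lift n e; rewrite phiE.
set N := (m + n)%N => e.
pose h := primitive (orbit_values f).
have hS i : h (i + 1) = h i + orbit_values f i by exact: primitiveS.
have [C h_cut] : exists C : int, forall i : int,
    h (iter N c i) = phi (x (i - 1), x i) + C.
  pose d (i : int) := h (iter N c i) - phi (x (i - 1), x i).
  have dS (j : int) : d (j + 1) = d j.
    have := congr1 (fun h => h j) e => /=; rewrite delta_triple_values /block_sum /d -/h.
    have -> : j + 1 - 1 = j by lia.
    by lia.
  by exists (d 0) => i; have := int_constant dS i; rewrite {1}/d; lia.
have [B phiB] : exists B : int, forall ab, `|phi ab| <= B.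
  have [|ab|B PB] := @finite_uniform_bound _ (fun ab B => `|phi ab| <= B%:Z).
  - by move=> ab N1 N2; lia.
  - by exists `|phi ab|%N; lia.
  - by exists B%:Z.
have [B1 fB1] := local_bounded (orbit_values_local f).
have [B2 hB2] := @bounded_on_blocks _ _ _ _ xc N h (B + `|C|) B1
  (fun i => ltac:(have := phiB (x (i - 1), x i); rewrite h_cut; lia))
  (fun i => ltac:(have := fB1 i; rewrite hS; lia)).
have [L hL] := bounded_primitive_local xc hS hB2 (orbit_values_local f).
(* The sign is that of the coboundary, which is a function minus its shift. *)
have [H Hh _] := @local_extension (fun i => - h i)
  (ex_intro _ L (fun y s ag => congr1 -%R (hL y s ag))).
apply/coker_pi_eq0; exists H; apply: orbit_values_inj; apply/funext => i.
by rewrite coboundary_orbit_values Hh hS; lia.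
Qed.

Lemma limQ_isomorphic : ord_isomorphic (limQ sigma) (dimension_group sigma).
Proof.
apply: (ord_isomorphic_of_relation lim_relB _ _ lim_rel_inj lim_rel_fun).
- move=> a; have [m [p ->]] := limQ_surj a.
  have [N [f [e _]]] := tower_function_exists m p; exists (piK f).
  by exists (m + N)%N, (iter (k * N) (betaQ sigma) p), f; rewrite lim_in_lift.
- move=> b; have [f ->] := coker_surj b; have [n [p [e _]]] := block_sums_exist f.
  by exists (lim_in beta (k * n) (piQ p)), n, p, f.
(* A positive class may come from an index not divisible by [k]; it is pushed to [k * n], and beta^Q
   preserves positivity. *)
- move=> a [n [y [[p p0 <-] ->]]].
  rewrite -[lim_in _ _ _](lim_in_iter _ (k * n - n)) subnK ?leq_pmull //.
  have -> : iter (k * n - n) beta (piQ p) = piQ (iter (k * n - n) (betaQ sigma) p).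
    exact: iter_coker_map.
  have := iter_ordHom_pos (betaQ sigma) (k * n - n) p0.
  move: (iter _ _ p) => q q0.
  have [N [f [e f0]]] := tower_function_exists n q; exists (piK f).
    by exists f => //; exact: f0.
  by exists (n + N)%N, (iter (k * N) (betaQ sigma) q), f; rewrite lim_in_lift.
move=> b [f f0 <-]; have [n [p [e p0]]] := block_sums_exist f.
exists (lim_in beta (k * n) (piQ p)); last by exists n, p, f.
by exists (k * n)%N, (piQ p); split=> //; exists p => //; exact: p0.
Qed.

End Comparison.

Theorem theorem3p12 (A : finType) (sigma : substitution A) :
  subst_primitive sigma -> subst_aperiodic sigma -> ~ subst_proper sigma ->
  ord_isomorphic (limQ sigma) (dimension_group sigma).
Proof.
move=> prim aper _; have [k [a [b [k0 abL ea eb big]]]] := fixed_pair prim aper.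
have [M xc] := limit_fixed_point prim aper abL ea eb big.
apply: (limQ_isomorphic k0 xc).
- exact: limit_cutS.
- exact: subword_block.
- exact: limit_word_language.
- exact: language_in_limit_word.
Qed.
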